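(* Let $\mu>0$ and $2<p<6$, and let $\mathcal G=(V,E)$ be a connected metric graph with set of vertices at infinity $V_\infty$. Assume that after removal of any edge $e\in E$, every connected component of the graph $(V,E\setminus\{e\})$ contains at least one vertex $v\in V_\infty$. Then $$\inf_{u\in H^1_\mu(\mathcal G)} E(u,\mathcal G)=\min_{\phi\in H^1_\mu(\mathbb R)} E(\phi,\mathbb R)=E(\phi_\mu,\mathbb R).$$
   Context: Metric graph: a connected multigraph $\mathcal G=(V,E)$ with $V$ and $E$ finite (multiple edges and self-loops allowed), where each edge $e\in E$ is associated with either a closed bounded interval $I_e=[0,\ell_e]$, $\ell_e>0$, or a closed half-line $I_e=[0,+\infty)$, with a coordinate $x_e$ along $I_e$ such that the ends of $I_e$ correspond to the two end vertices of $e$. If $I_e$ is a half-line, it is attached to the rest of the graph at $x_e=0$, and the vertex corresponding to $x_e=+\infty$ is called a vertex at infinity; $V_\infty\subseteq V$ is the set of vertices at infinity, and every vertex at infinity is assumed to have degree one. As a metric space, $\mathcal G$ is the disjoint union of the $I_e$ with endpoints glued at the vertices in $V\setminus V_\infty$ according to the graph, with the shortest-path distance (vertices at infinity are not points of this space, but they are vertices of the graph; in particular, removing a half-line $e$ leaves its vertex at infinity as an isolated vertex, which is a connected component of $(V,E\setminus\{e\})$). Functions: $u:\mathcal G\to\mathbb R$ is identified with the family $(u_e)_{e\in E}$ of its restrictions to the edges. $\|u\|_{L^r(\mathcal G)}^r=\sum_e\|u_e\|_{L^r(I_e)}^r$; $H^1(\mathcal G)$ is the set of $u$ continuous on $\mathcal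 G$ with $u_e\in H^1(I_e)$ for all $e$. For $\mu>0$, $H^1_\mu(\mathcal G)=\{u\in H^1(\mathcal G):\|u\|_{L^2(\mathcal G)}^2=\mu\}$. The NLS energy is $$E(u,\mathcal G)=\tfrac12\|u'\|_{L^2(\mathcal G)}^2-\tfrac1p\|u\|_{L^p(\mathcal G)}^p=\tfrac12\sum_e\int_{I_e}|u_e'|^2\,dx_e-\tfrac1p\sum_e\int_{I_e}|u_e|^p\,dx_e .$$ The same notation is used with $\mathcal G$ replaced by $\mathbb R$. Soliton: $\phi_\mu$ denotes the unique positive and even minimizer of $E(\cdot,\mathbb R)$ over $H^1_\mu(\mathbb R)$ (the dependence on $p$ is understood). It is given by $\phi_\mu(x)=\mu^\alpha\phi_1(\mu^\beta x)$ with $\alpha=\frac{2}{6-p}$, $\beta=\frac{p-2}{6-p}$ and $\phi_1(x)=C_p\,\mathrm{sech}(c_p x)^{\alpha/\beta}$ for suitable constants $C_p,c_p>0$. *)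

(* Defs.v *)
From HB Require Import structures.
From mathcomp Require Import all_boot all_order all_algebra.
From mathcomp Require Import all_classical all_reals all_analysis.
Import Order.TTheory GRing.Theory Num.Theory.
Import numFieldNormedType.Exports.

Set Implicit Arguments.
Unset Strict Implicit.
Unset Printing Implicit Defensive.

Local Open Scope classical_set_scope.
Local Open Scope ring_scope.

(* Edge [e] carries the interval I_e with x_e = 0 at [tail e]; its other end is
   [head e].  The edge is a half-line exactly when [len e = +oo], and then
   [head e] is a vertex at infinity. *)
Record edge_data (R : realType) := EdgeData {
  vertex : finType;
  edge : finType;
  tail : edge -> vertex;
  head : edge -> vertex;
  len : edge -> \bar R
}.

Section Combinatorics.
Context {R : realType}.
Implicit Type G : edge_data R.

Definition Vinf G : {set vertex G} :=
  [set head e | e in [set e : edge G | len e == +oo%E]]%SET.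

(* A self-loop contributes 2. *)
Definition degree G (v : vertex G) : nat :=
  (\sum_(e : edge G) ((tail e == v) + (head e == v)))%N.

Definition adj G (A : {set edge G}) : rel (vertex G) :=
  fun v w => [exists e in A,
    ((tail e == v) && (head e == w)) || ((tail e == w) && (head e == v))].

(* Vertex sets of the connected components of the graph (V, A). *)
Definition components G (A : {set edge G}) : {set {set vertex G}} :=
  [set [set w | connect (adj A) v w] | v : vertex G]%SET.

(* [edge_nonempty] excludes the graph reduced to a single vertex, on which
   every function has zero mass. *)
Record metric_graph G : Prop := MetricGraph {
  len_gt0 : forall e : edge G, (0 < len e)%E;
  edge_nonempty : (0 < #|edge G|)%N;
  graph_connected : forall v w : vertex G, connect (adj [set: edge G]%SET) v w;
  degree_Vinf : forall v : vertex G, v \in Vinf G -> degree v = 1%N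
}.

End Combinatorics.

Section Sobolev.
Context {R : realType}.
Implicit Types (I : set R) (r : R) (u g : R -> R).

Definition Lpow I r u : \bar R :=
  (\int[@lebesgue_measure R]_(x in I) (`|u x| `^ r)%:E)%E.

Definition in_L2 I u : Prop := measurable_fun I u /\ (Lpow I 2 u < +oo)%E.

(* C^1_c(J), J the interior of I; functions are extended by zero to R. *)
Definition test_function I (f : R -> R) : Prop :=
  [/\ forall x, derivable f x 1,
      continuous (derive1 f),
      compact (closure [set x | f x != 0]) &
      closure [set x | f x != 0] `<=` I°].

Definition weak_derivative I u g : Prop :=
  forall f, test_function I f ->
    (\int[@lebesgue_measure R]_(x in I) (u x * derive1 f x)%:E =
     - \int[@lebesgue_measure R]_(x in I) (g x * f x)%:E)%E.

Definition H1 I u : Prop :=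
  in_L2 I u /\ exists2 g, in_L2 I g & weak_derivative I u g.

(* The L^2 weak derivative of [u], determined up to a null set of [I] when
   [u] is in H^1(I); the zero function otherwise. *)
Definition wderiv I u : R -> R :=
  xget (fun=> 0) [set g | in_L2 I g /\ weak_derivative I u g].

End Sobolev.

Section GraphFunctions.
Context {R : realType}.
Variable G : edge_data R.

Definition interval (e : edge G) : set R :=
  [set x | 0 <= x /\ (x%:E <= len e)%E].

(* The point of coordinate [x] on [e] is the vertex [v]; this never happens
   for [v] at infinity. *)
Definition at_vertex (e : edge G) (x : R) (v : vertex G) : Prop :=
  (x = 0 /\ v = tail e) \/ (x%:E = len e /\ v = head e).

(* A function on the metric graph is given by its restrictions [u e] to the
   edges; only the values of [u e] on [interval e] are relevant. *)
Definition continuous_on_graph (u : edge G -> R -> R) : Prop :=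
  (forall e, {within interval e, continuous (u e)}) /\
  (forall e f x y v, at_vertex e x v -> at_vertex f y v -> u e x = u f y).

Definition graph_H1 (u : edge G -> R -> R) : Prop :=
  continuous_on_graph u /\ forall e, H1 (interval e) (u e).

Definition graph_Lpow (r : R) (u : edge G -> R -> R) : \bar R :=
  (\sum_(e : edge G) Lpow (interval e) r (u e))%E.

Definition graph_H1m (m : R) : set (edge G -> R -> R) :=
  [set u | graph_H1 u /\ graph_Lpow 2 u = m%:E].

Definition graph_energy (p : R) (u : edge G -> R -> R) : \bar R :=
  ((2^-1)%:E * graph_Lpow 2 (fun e => wderiv (interval e) (u e))
   - (p^-1)%:E * graph_Lpow p u)%E.

End GraphFunctions.

Section RealLine.
Context {R : realType}.

Definition line_H1m (m : R) : set (R -> R) :=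
  [set u | [/\ continuous u, H1 [set: R] u & Lpow [set: R] 2 u = m%:E]].

Definition line_energy (p : R) (u : R -> R) : \bar R :=
  ((2^-1)%:E * Lpow [set: R] 2 (wderiv [set: R] u)
   - (p^-1)%:E * Lpow [set: R] p u)%E.

Definition line_minimizer (p m : R) (f : R -> R) : Prop :=
  line_H1m m f /\
  forall u, line_H1m m u -> (line_energy p f <= line_energy p u)%E.

(* If there were no positive even minimizer this would be the zero function,
   which has zero mass and is therefore never a [line_minimizer] for m > 0. *)
Definition soliton (p m : R) : R -> R :=
  xget (fun=> 0) [set f | [/\ line_minimizer p m f,
    forall x, 0 < f x & forall x, f (- x) = f x]].

End RealLine.

(* Main.v *)
(* A calibration argument replaces rearrangement.  Rescale
   [F(s) = s sqrt (1 - (2/p) s^(p-2))] to a function [F_lam] that vanishes at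
   [M = sup |u|], and let [Phi' = F_lam], [Phi(0) = 0] and [w = lam^(p-2)].  As
   [F_lam(s)^2 = w s^2 - (2/p) s^p] for [0 <= s <= M],
   [E(u) + w m / 2] is the integral of [(u'^2 + F_lam(|u|)^2) / 2 >= |u'| F_lam(|u|)],
   hence bounds the total variation of [Phi |u|], which is at least [2 Phi(M)]:
   the superlevel sets of [Phi |u|] avoid the vertices at infinity, so by the
   hypothesis on the graph each of them is cut at least twice.  The resulting bound
   [2 Phi(M) - w m / 2] depends only on the scale [lam] of the peak; by Young's
   inequality (here [p < 6]) it is smallest at the scale of the soliton of mass
   [m], for which all these inequalities are equalities.
   Conversely, on a half-line the odd differences
   [phi(x - n) - phi(x + n)], normalised in L^2, have energies tending to [E(phi)]. *)
Require Import Defs.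
From mathcomp Require Import all_boot all_order all_algebra.
From mathcomp Require Import all_classical all_reals all_analysis.
Import Order.TTheory GRing.Theory Num.Theory.
Import numFieldNormedType.Exports.
From mathcomp Require Import measurable_realfun.
From mathcomp Require Import ring lra.

Set Implicit Arguments.
Unset Strict Implicit.
Unset Printing Implicit Defensive.

Local Open Scope classical_set_scope.
Local Open Scope ring_scope.

(** * Edge cuts *)

(** [F] comes from the first integral of the soliton equation: [phi'' = w phi - phi^(p-1)] with
    decay at infinity gives [phi'^2 = w phi^2 - (2/p) phi^p], that is [|phi'| = F_lam(phi)], which
    is the equality case of AM-GM. The soliton also takes each value below its peak exactly twice,
    so the factor in [2 Phi(M)] is sharp on the line. The scale of [F_lam] must be matched to [M],
    not to the mass: the formula for [F_lam^2] holds only up to the zero of [F_lam], since the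
    radicand is negative beyond it. The bound therefore carries a scale unrelated to the soliton of
    mass [m], and a separate minimisation over scales is required. The analytic obstacle is that [u]
    is only continuous with a weak derivative, so [Phi |u|] cannot be differentiated pointwise. Its
    variation is controlled from the integral formula for increments of [u] alone. For the
    competitors, [phi] being even makes the odd difference vanish at 0, so it extends by zero to the
    rest of the graph and stays C^1 on every edge, without any truncation. *)

Section EdgeCuts.
Context {R : realType}.
Variable G : edge_data R.
Hypothesis G_infinity : forall (e : edge G) (C : {set vertex G}),
  C \in components [set~ e]%SET ->
  exists v : vertex G, v \in Vinf G /\ v \in C.
Implicit Types (S : {set vertex G}) (e f : edge G).

Definition crosses S e : bool := (Defs.tail e \in S) (+) (Defs.head e \in S).

(** If only [f] could cross [S], membership in [S] would be constant along the edges of the graph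
    without [f]. The component of [v] there would lie in [S], yet it contains a vertex at
    infinity. *)
Lemma crossing_edge_avoiding S f (v : vertex G) :
  (forall v : vertex G, v \in S -> v \notin Vinf G) -> v \in S ->
  exists2 e, e != f & crosses S e.
Proof.
move=> SV vS.
have [[e ef eS]|none] := pselect (exists2 e, e != f & crosses S e).
  by exists e.
have [|w [wV]] := @G_infinity f [set w | connect (adj [set~ f]%SET) v w]%SET.
  exact: imset_f.
rewrite inE => vw.
have cl x y : adj [set~ f]%SET x y -> (x \in S) = (y \in S).
  move=> /existsP[e /andP[]]; rewrite !inE => ef xy.
  have /negbTE : ~~ crosses S e by apply/negP => eS; apply: none; exists e.
  by rewrite /crosses; case/orP: xy => /andP[/eqP-> /eqP->]; do 2 case: (_ \in S).
have := closed_connect cl vw; rewrite vS => /esym wS.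
by have := SV _ wS; rewrite wV.
Qed.

(** If both ends of [e0] are in [S], then [e0] does not cross, and avoiding a first crossing edge
    yields a second one, also different from [e0]. If only one end is in [S], it suffices to avoid
    [e0]. The edge [e0] is left out because it will carry the point where the function is evaluated,
    and its variation is counted separately on both sides of that point. *)
Lemma cut_ge_endpoints S e0 : (forall v : vertex G, v \in S -> v \notin Vinf G) ->
  ((Defs.tail e0 \in S) + (Defs.head e0 \in S) <=
   \sum_(e | e != e0) crosses S e)%N.
Proof.
move=> SV.
have crossing_avoiding (v : vertex G) : v \in S ->
    exists2 e, e != e0 & crosses S e.
  exact: crossing_edge_avoiding.
have [tS|tS] := boolP (Defs.tail e0 \in S); have [hS|hS] := boolP (Defs.head e0 \in S).
- have [f f0 fS] := crossing_avoiding _ tS.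
  have [e ef eS] := crossing_edge_avoiding f SV tS.
  have ee0 : e != e0.
    by apply/eqP => ee0; move: eS; rewrite ee0 /crosses tS hS.
  by rewrite (bigD1 f)//= (bigD1 e) ?ee0//= fS eS.
- have [f f0 fS] := crossing_avoiding _ tS.
  by rewrite (bigD1 f)//= fS.
- have [f f0 fS] := crossing_avoiding _ hS.
  by rewrite (bigD1 f)//= fS.
- by [].
Qed.

(* Discrete coarea formula: [h] is peeled one level set at a time, and each
   level set is cut by enough edges. *)
Lemma potential_variation_ge (h : vertex G -> R) e0 : (forall v, 0 <= h v) ->
  (forall v, v \in Vinf G -> h v = 0) ->
  h (Defs.tail e0) + h (Defs.head e0) <=
  \sum_(e | e != e0) `|h (Defs.tail e) - h (Defs.head e)|.
Proof.
have [n] := ubnP #|[set v | 0 < h v]%SET|.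
elim: n h => // n IH h; rewrite ltnS => hn h0 hV.
set S := [set v | 0 < h v]%SET in hn *.
have [S0|[v0 v0S]] := set_0Vmem S.
  have hz v : h v = 0.
    apply/eqP; rewrite eq_le h0 andbT leNgt; apply/negP => hv.
    have : v \in S by rewrite inE.
    by rewrite S0 inE.
  by rewrite !hz addr0 sumr_ge0.
(* [d] is the least positive value of [h]. Lowering [h] by [d] on its support [S] keeps it
   nonnegative and removes at least one vertex from the support. *)
pose d := h [arg min_(v < v0 in S) h v]%O.
have [d_gt0 d_le d_att] : [/\ 0 < d, (forall v, v \in S -> d <= h v) &
    exists2 v, v \in S & h v = d].
  rewrite /d; case: Order.TotalTheory.arg_minP => // v vS vmin; split.
  - by move: vS; rewrite inE.
  - by move=> w; exact: vmin.
  - by exists v.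
pose k v := h v - d * (v \in S)%:R.
have hS0 v : v \notin S -> h v = 0.
  by move=> vS; apply/eqP; rewrite eq_le h0 andbT leNgt; move: vS; rewrite inE.
have kS v : v \notin S -> k v = 0.
  by move=> vS; rewrite /k (negbTE vS) mulr0 subr0 hS0.
have k0 v : 0 <= k v.
  have [vS|vS] := boolP (v \in S); last by rewrite kS.
  by rewrite /k vS mulr1 subr_ge0 d_le.
have kV v : v \in Vinf G -> k v = 0.
  by move=> vV; apply: kS; rewrite inE hV// ltxx.
have kn : (#|[set v | (0 < k v)%R]%SET| < n)%N.
  apply: leq_trans hn; apply: proper_card; apply/properP; split.
    apply/fintype.subsetP => v; rewrite inE; apply: contraTT => vS.
    by rewrite kS// ltxx.
  have [v vS hv] := d_att; exists v => //.
  by rewrite inE /k vS hv mulr1 subrr ltxx.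
have := IH k kn k0 kV => kle.
have SV (v : vertex G) : v \in S -> v \notin Vinf G.
  rewrite inE => hv.
  by apply/negP => /hV vE; rewrite vE ltxx in hv.
have cut := cut_ge_endpoints e0 SV.
(* An edge loses exactly [d] of variation if it crosses [S], because [h] vanishes at its outer end,
   and nothing otherwise. *)
have edgeE e : `|h (Defs.tail e) - h (Defs.head e)| =
    `|k (Defs.tail e) - k (Defs.head e)| + d * (crosses S e)%:R.
  rewrite /crosses /k.
  have [tS|tS] := boolP (Defs.tail e \in S); have [hS|hS] := boolP (Defs.head e \in S);
    rewrite /= ?mulr1 ?mulr0 ?subr0 ?addr0.
  - by congr (`|_|); ring.
  - by rewrite (hS0 _ hS) !subr0 !ger0_norm ?subrK ?subr_ge0 ?d_le.
  - by rewrite (hS0 _ tS) !sub0r !normrN !ger0_norm ?subrK ?subr_ge0 ?d_le.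
  - by [].
rewrite (eq_bigr _ (fun e _ => edgeE e)) big_split/= -mulr_sumr -natr_sum.
have -> : h (Defs.tail e0) + h (Defs.head e0) = k (Defs.tail e0) + k (Defs.head e0) +
    d * ((Defs.tail e0 \in S) + (Defs.head e0 \in S))%:R.
  by rewrite /k natrD; ring.
by rewrite lerD// ler_wpM2l ?ler_nat// ltW.
Qed.

End EdgeCuts.

(** * Weak derivatives on an interval *)

Section DerivativeRules.
Context {R : realType}.
Implicit Types (f g : R -> R) (x a b c : R).

Lemma is_derive_val_eq f x a b :
  is_derive x (1 : R) f a -> a = b -> is_derive x (1 : R) f b.
Proof. by move=> fa <-. Qed.

Lemma is_derive_add f g x a b : is_derive x (1 : R) f a -> is_derive x (1 : R) g b ->
  is_derive x (1 : R) (fun t => f t + g t) (a + b).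
Proof. by move=> fa gb; exact: is_deriveD. Qed.

Lemma is_derive_sub f g x a b : is_derive x (1 : R) f a -> is_derive x (1 : R) g b ->
  is_derive x (1 : R) (fun t => f t - g t) (a - b).
Proof. by move=> fa gb; exact: is_deriveB. Qed.

Lemma is_derive_opp f x a : is_derive x (1 : R) f a ->
  is_derive x (1 : R) (fun t => - f t) (- a).
Proof. by move=> fa; exact: is_deriveN. Qed.

Lemma is_derive_mul f g x a b : is_derive x (1 : R) f a -> is_derive x (1 : R) g b ->
  is_derive x (1 : R) (fun t => f t * g t) (a * g x + f x * b).
Proof.
move=> fa gb; apply: (is_derive_val_eq (is_deriveM fa gb)).
by rewrite /GRing.scale/= addrC [g x * a]mulrC.
Qed.

Lemma is_derive_scale k f x a : is_derive x (1 : R) f a ->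
  is_derive x (1 : R) (fun t => k * f t) (k * a).
Proof. by move=> fa; exact: is_deriveZ. Qed.

Lemma is_derive_comp f g x a b :
  is_derive (g x) (1 : R) f a -> is_derive x (1 : R) g b ->
  is_derive x (1 : R) (fun t => f (g t)) (a * b).
Proof. by move=> fa gb; exact: (@is_derive1_comp _ f g). Qed.

Lemma is_derive_affine k c x : is_derive x (1 : R) (fun t => k * (t - c)) k.
Proof.
have := is_derive_scale k (is_derive_sub (is_derive_id x (1 : R)) (is_derive_cst c x 1)).
by move=> H; apply: (is_derive_val_eq H); rewrite subr0 mulr1.
Qed.

Lemma is_derive_continuous f x a : is_derive x (1 : R) f a -> {for x, continuous f}.
Proof.
by move=> [df _]; apply: differentiable_continuous; exact/derivable1_diffP.
Qed.

Lemma is_derive_derive1 f x a : is_derive x (1 : R) f a -> f^`()%classic x = a.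
Proof. by move=> fa; rewrite derive1E derive_val. Qed.

End DerivativeRules.

(** * Piecewise quadratic C^1 steps *)

Section Cutoff.
Context {R : realType}.
Implicit Types (x y s t : R).

Definition pospart (s : R) : R := Num.max 0 s.

Lemma continuous_pospart : continuous pospart.
Proof. by move=> x; apply: continuous_max; [exact: cvg_cst|exact: cvg_id]. Qed.

Lemma is_derive_sqr_pospart (x : R) :
  is_derive x 1 (fun s => pospart s ^+ 2) (2 * pospart x).
Proof.
have [x0|x0|<-] := ltgtP 0 x.
- apply: (@near_eq_is_derive _ _ _ (fun s => s ^+ 2)).
  + near=> s; rewrite /pospart max_r//; near: s.
    by apply: filterS (lt_nbhsr x0) => s /ltW.
  + rewrite /pospart max_r ?ltW//.
    by apply: is_derive_eq; rewrite /GRing.scale/= mulr1; ring.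
- apply: (@near_eq_is_derive _ _ _ (fun=> 0)).
  + near=> s; rewrite /pospart max_l ?expr0n//; near: s.
    by apply: filterS (lt_nbhsl x0) => s /ltW.
  + rewrite /pospart max_l ?ltW// mulr0. exact: is_derive_cst.
(* At 0 the difference quotient of the square of [pospart] is [pospart] itself, which is continuous
   and vanishes there. *)
- apply/is_derive1_caratheodory; exists pospart; split.
  + move=> z; rewrite /pospart maxxx expr0n/= !subr0.
    by case: (leP 0 z) => z0; ring.
  + exact: continuous_pospart.
  + by rewrite /pospart maxxx mulr0.
Unshelve. all: by end_near. Qed.

(** A C^1 step from 0 to 1 on [[0, 1]], obtained as a second difference of the truncated square. Its
    derivative [smoothbump] is the tent of height 2 on [[0, 1]]. Test functions are C^1, so this
    regularity is the right one. *)
Definition smoothstep (s : R) : R :=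
  2 * pospart s ^+ 2 - 4 * pospart (s - 2^-1) ^+ 2 + 2 * pospart (s - 1) ^+ 2.

Definition smoothbump (s : R) : R :=
  4 * pospart s - 8 * pospart (s - 2^-1) + 4 * pospart (s - 1).

Lemma continuous_smoothbump : continuous smoothbump.
Proof.
move=> x; apply: cvgD; first apply: cvgB.
- by apply: cvgM; [exact: cvg_cst|exact: continuous_pospart].
- apply: cvgM; first exact: cvg_cst.
  apply: (@continuous_comp _ _ _ (fun s : R => s - _) pospart).
    by apply: cvgB; [exact: cvg_id|exact: cvg_cst].
  exact: continuous_pospart.
- apply: cvgM; first exact: cvg_cst.
  apply: (@continuous_comp _ _ _ (fun s : R => s - _) pospart).
    by apply: cvgB; [exact: cvg_id|exact: cvg_cst].
  exact: continuous_pospart.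
Qed.

Lemma smoothbump_ge0 s : 0 <= smoothbump s.
Proof.
rewrite /smoothbump /pospart.
case: (leP 0 s) => ?; case: (leP 0 (s - 2^-1)) => ?; case: (leP 0 (s - 1)) => ?; lra.
Qed.

Lemma smoothbump_out s : s <= 0 \/ 1 <= s -> smoothbump s = 0.
Proof.
rewrite /smoothbump /pospart.
case: (leP 0 s) => ?; case: (leP 0 (s - 2^-1)) => ?; case: (leP 0 (s - 1)) => ?; lra.
Qed.

Lemma smoothstep_le0 s : s <= 0 -> smoothstep s = 0.
Proof.
rewrite /smoothstep /pospart => s0.
rewrite !max_l ?expr0n/= ?mulr0; lra.
Qed.

Lemma smoothstep_ge1 s : 1 <= s -> smoothstep s = 1.
Proof.
rewrite /smoothstep /pospart => s0.
rewrite !max_r; [|lra..]; by field.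
Qed.

Lemma smoothstep_itv s : 0 <= smoothstep s <= 1.
Proof.
rewrite /smoothstep /pospart.
case: (leP 0 s) => ?; case: (leP 0 (s - 2^-1)) => ?; case: (leP 0 (s - 1)) => ?;
  apply/andP; split; nra.
Qed.

Lemma is_derive_smoothstep s : is_derive s (1 : R) smoothstep (smoothbump s).
Proof.
have D c : is_derive s (1 : R) (fun t => pospart (t - c) ^+ 2) (2 * pospart (s - c)).
  have subD := is_derive_sub (is_derive_id s (1 : R)) (is_derive_cst c s 1).
  have := @is_derive_comp _ (fun t => pospart t ^+ 2) (fun t => t - c) _ _ _
    (is_derive_sqr_pospart (s - c)) subD.
  by move=> H; apply: (is_derive_val_eq H); rewrite subr0 mulr1.
have D0 := is_derive_sqr_pospart s.
have H := is_derive_add (is_derive_sub (is_derive_scale 2 D0)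
  (is_derive_scale 4 (D 2^-1))) (is_derive_scale 2 (D 1)).
by apply: (is_derive_val_eq H); rewrite /smoothbump; ring.
Qed.

End Cutoff.

(** * Square-integrable functions and approximate identities *)

Section DuBoisReymond.
Context {R : realType}.
Notation mu := (@lebesgue_measure R).
Implicit Types (I J : set R) (x y c eps : R) (u g f : R -> R).

Lemma integral_vanish_outside I J (f : R -> \bar R) : J `<=` I ->
  (forall x, I x -> ~ J x -> f x = 0%E) ->
  (\int[mu]_(x in I) f x = \int[mu]_(x in J) f x)%E.
Proof.
move=> JI f0; rewrite [LHS]integral_mkcond [RHS]integral_mkcond.
apply: eq_integral => x _; rewrite !patchE.
have [Jx|nJx] := pselect (J x); first by rewrite !mem_set//; exact: JI.
rewrite [x \in J]memNset//; have [Ix|nIx] := pselect (I x).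
  by rewrite mem_set// f0.
by rewrite memNset.
Qed.

Lemma powR2_sqr (r : R) : `|r| `^ 2 = r ^+ 2.
Proof. by rewrite powR_mulrn// real_normK// num_real. Qed.

Lemma in_L2_sqr I g : in_L2 I g <->
  measurable_fun I g /\ (\int[mu]_(x in I) (g x ^+ 2)%:E < +oo)%E.
Proof.
rewrite /in_L2 /Lpow.
by under eq_integral do rewrite powR2_sqr.
Qed.

(** On a set of finite measure [1 + g^2] is integrable, and it dominates [|g|]. *)
Lemma in_L2_integrable I J g : measurable I -> measurable J -> J `<=` I ->
  (mu J < +oo)%E -> in_L2 I g -> mu.-integrable J (EFin \o g).
Proof.
move=> mI mJ JI Joo /in_L2_sqr[mg goo].
have mgJ : measurable_fun J g by exact: measurable_funS mg.
have i2 : mu.-integrable J (EFin \o (fun x => g x ^+ 2)).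
  apply/integrableP; split.
    by apply/measurable_EFinP; exact: measurable_funX.
  apply: le_lt_trans goo; under eq_integral => x _ do
    rewrite /= ger0_norm ?sqr_ge0//.
  apply: ge0_subset_integral => //.
  - by apply/measurable_EFinP; exact: measurable_funX.
  - by move=> x _; rewrite lee_fin sqr_ge0.
have i1 : mu.-integrable J (EFin \o (fun=> 1 : R)).
  apply: measurable_bounded_integrable => //.
  by exists 1; split => // M M1 x _ /=; rewrite normr1 ltW.
have i12 : mu.-integrable J (EFin \o (fun x => 1 + g x ^+ 2)).
  exact: integrableD i1 i2.
apply: le_integrable i12 => //; first exact/measurable_EFinP.
move=> x Jx; rewrite /= lee_fin [leRHS]ger0_norm ?addr_ge0 ?sqr_ge0//.
rewrite -(real_normK (num_real (g x))); have := normr_ge0 (g x); nra.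
Qed.

(** A one-sided approximate identity at [c]: a tent of mass one carried by [[c, c + eps]], the
    derivative of [ramp]. *)
Definition bump c eps (t : R) : R := eps^-1 * smoothbump (eps^-1 * (t - c)).

Definition ramp c eps (t : R) : R := smoothstep (eps^-1 * (t - c)).

Lemma is_derive_ramp c eps t : is_derive t (1 : R) (ramp c eps) (bump c eps t).
Proof.
have := @is_derive_comp _ smoothstep (fun t => eps^-1 * (t - c)) _ _ _
  (is_derive_smoothstep _) (is_derive_affine eps^-1 c t).
by move=> H; apply: (is_derive_val_eq H); rewrite mulrC.
Qed.

Lemma continuous_bump c eps : continuous (bump c eps).
Proof.
move=> t; apply: cvgM; first exact: cvg_cst.
apply: (@continuous_comp _ _ _ (fun t => eps^-1 * (t - c)) smoothbump).
  by apply: cvgM; [exact: cvg_cst|apply: cvgB; [exact: cvg_id|exact: cvg_cst]].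
exact: continuous_smoothbump.
Qed.

Lemma bump_ge0 c eps t : 0 < eps -> 0 <= bump c eps t.
Proof. by move=> e0; rewrite mulr_ge0 ?smoothbump_ge0// invr_ge0 ltW. Qed.

Lemma bump_out c eps t : 0 < eps -> t <= c \/ c + eps <= t -> bump c eps t = 0.
Proof.
move=> e0 tc; rewrite /bump smoothbump_out ?mulr0//.
case: tc => tc; [left|right].
  by rewrite mulr_ge0_le0 ?subr_le0 ?invr_ge0// ltW.
by rewrite mulrC ler_pdivlMr// mul1r lerBrDl.
Qed.

Lemma ramp_le c eps t : 0 < eps -> t <= c -> ramp c eps t = 0.
Proof.
move=> e0 tc; rewrite /ramp smoothstep_le0//.
by rewrite mulr_ge0_le0 ?subr_le0 ?invr_ge0// ltW.
Qed.

Lemma ramp_ge c eps t : 0 < eps -> c + eps <= t -> ramp c eps t = 1.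
Proof.
move=> e0 tc; rewrite /ramp smoothstep_ge1//.
by rewrite mulrC ler_pdivlMr// mul1r lerBrDl.
Qed.

Lemma within_continuous_integrable f x y : {within `[x, y], continuous f} ->
  mu.-integrable `[x, y] (EFin \o f).
Proof.
by move=> cf; apply: continuous_compact_integrable => //; exact: segment_compact.
Qed.

Lemma Rintegral_FTC f F x y : x < y -> continuous f ->
  (forall t, is_derive t (1 : R) F (f t)) ->
  \int[mu]_(t in `[x, y]) f t = F y - F x.
Proof.
move=> xy cf dF; have cF : continuous F by move=> t; exact: is_derive_continuous.
rewrite /Rintegral (@continuous_FTC2 _ f F)//.
- exact: continuous_subspaceT.
- split; first by move=> t _; case: (dF t).
  + by apply: cvg_at_right_filter; exact: cF.
  + by apply: cvg_at_left_filter; exact: cF.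
- by move=> t _; exact: is_derive_derive1.
Qed.

Lemma Rintegral_bump c eps x y : 0 < eps -> x <= c -> c + eps <= y ->
  \int[mu]_(t in `[x, y]) bump c eps t = 1.
Proof.
move=> e0 xc cy; rewrite (Rintegral_FTC _ _ (is_derive_ramp c eps)).
- by rewrite ramp_ge// ramp_le// subr0.
- by rewrite (le_lt_trans xc)// (lt_le_trans _ cy)// ltrDl.
- exact: continuous_bump.
Qed.

Lemma bump_average f c eps x y (f0 d : R) : 0 < eps -> x <= c -> c + eps <= y ->
  {within `[x, y], continuous f} ->
  (forall t, c <= t <= c + eps -> `|f t - f0| <= d) ->
  `|\int[mu]_(t in `[x, y]) (f t * bump c eps t) - f0| <= d.
Proof.
move=> e0 xc cy cf fd.
have cb : {within `[x, y], continuous (bump c eps)}.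
  by apply: continuous_subspaceT; exact: continuous_bump.
have ifb : mu.-integrable `[x, y] (EFin \o (fun t => f t * bump c eps t)).
  apply: within_continuous_integrable => t; apply: cvgM; [exact: cf|exact: cb].
have icb k : mu.-integrable `[x, y] (EFin \o (fun t => k * bump c eps t)).
  apply: within_continuous_integrable => t; apply: cvgM; [exact: cvg_cst|exact: cb].
have ib := within_continuous_integrable cb.
have E k : \int[mu]_(t in `[x, y]) (k * bump c eps t) = k.
  by rewrite RintegralZl// Rintegral_bump// mulr1.
rewrite -[X in _ - X]E -RintegralB//.
have idb : mu.-integrable `[x, y]
    (EFin \o (fun t => f t * bump c eps t - f0 * bump c eps t)).
  by have := integrableB _ ifb (icb f0); exact.
apply: le_trans (le_normr_Rintegral _ idb) _ => //.
rewrite -[leRHS]E; apply: le_Rintegral => //.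
  exact: (integrable_norm idb).
move=> t _; rewrite -mulrBl normrM (ger0_norm (bump_ge0 _ _ e0)).
have [|tc] := boolP (c <= t <= c + eps).
  by move=> /fd ?; rewrite ler_wpM2r// bump_ge0.
rewrite bump_out ?mulr0//; move: tc; rewrite negb_and -!ltNge.
by case/orP => /ltW; [left|right].
Qed.

End DuBoisReymond.

(** * The fundamental theorem of calculus for weak derivatives *)

Section WeakDerivativeFTC.
Context {R : realType}.
Notation mu := (@lebesgue_measure R).
Implicit Types (I J : set R) (x y c eps : R) (u g f : R -> R).

(** It rises on [[x + eps, x + 2 eps]] and falls on [[y - 2 eps, y - eps]]. The margins of width
    [eps] keep the closed support inside []x, y[], hence inside the interior of [I], even when [x]
    or [y] is an end of [I]. *)
Definition cutoff x y eps (t : R) : R :=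
  ramp (x + eps) eps t - ramp (y - 2 * eps) eps t.

Definition dcutoff x y eps (t : R) : R :=
  bump (x + eps) eps t - bump (y - 2 * eps) eps t.

Lemma is_derive_cutoff x y eps t :
  is_derive t (1 : R) (cutoff x y eps) (dcutoff x y eps t).
Proof. by apply: is_derive_sub; exact: is_derive_ramp. Qed.

Section Cutoff.
Variables (x y eps : R).
Hypothesis (eps_gt0 : 0 < eps) (eps_le : 4 * eps <= y - x).

Lemma cutoff_out t : t <= x + eps \/ y - eps <= t ->
  cutoff x y eps t = 0 /\ dcutoff x y eps t = 0.
Proof.
move: eps_gt0 eps_le => e0 ele; rewrite /cutoff /dcutoff; case=> tx.
  by rewrite !ramp_le ?bump_out ?subrr//; first [lra|left; lra].
by rewrite !ramp_ge ?bump_out ?subrr//; first [lra|right; lra].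
Qed.

Lemma cutoff_plateau t : x + 2 * eps <= t <= y - 2 * eps -> cutoff x y eps t = 1.
Proof.
move: eps_gt0 eps_le => e0 ele /andP[xt ty].
by rewrite /cutoff ramp_ge ?ramp_le ?subr0//; lra.
Qed.

Lemma normr_cutoff_le1 t : `|cutoff x y eps t| <= 1.
Proof.
rewrite /cutoff /ramp ler_norml.
have /andP[? ?] := smoothstep_itv (eps^-1 * (t - (x + eps))).
by have /andP[? ?] := smoothstep_itv (eps^-1 * (t - (y - 2 * eps))); lra.
Qed.

Lemma continuous_dcutoff : continuous (dcutoff x y eps).
Proof. by move=> t; apply: cvgB; exact: continuous_bump. Qed.

Lemma derive1_cutoff t : (cutoff x y eps)^`()%classic t = dcutoff x y eps t.
Proof. exact: is_derive_derive1 (is_derive_cutoff _ _ _ _). Qed.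

Lemma test_function_cutoff I : `[x, y] `<=` I -> test_function I (cutoff x y eps).
Proof.
move=> xyI.
have sub : closure [set t | cutoff x y eps t != 0] `<=` `[x + eps, y - eps].
  have /closure_id -> : closed `[x + eps, y - eps] by exact: interval_closed.
  apply: closure_subset => t /=; rewrite in_itv/= => t0.
  apply/andP; split; rewrite leNgt; apply/negP => tlt; move/negP: t0; apply.
    by have [-> _] := cutoff_out (or_introl (ltW tlt)).
  by have [-> _] := cutoff_out (or_intror (ltW tlt)).
split.
- by move=> t; case: (is_derive_cutoff x y eps t).
- have -> : derive1 (cutoff x y eps) = dcutoff x y eps.
    by apply/funext => t; exact: derive1_cutoff.
  exact: continuous_dcutoff.
- apply: subclosed_compact sub; first exact: closed_closure.
  exact: segment_compact.
- apply: (subset_trans sub); apply: (@subset_trans _ `]x, y[).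
    by apply: subset_itv; rewrite bnd_simp; move: eps_gt0 => ?; lra.
  rewrite -open_subsetE; last exact: interval_open.
  apply: subset_trans xyI; exact: subset_itv_oo_cc.
Qed.

Lemma weak_derivative_cutoff I u g : `[x, y] `<=` I -> weak_derivative I u g ->
  (\int[mu]_(t in `[x, y]) (u t * dcutoff x y eps t)%:E =
   - \int[mu]_(t in `]x, y[) (g t * cutoff x y eps t)%:E)%E.
Proof.
move=> xyI /(_ _ (test_function_cutoff xyI)).
rewrite (@integral_vanish_outside _ I `[x, y])//; last first.
  move=> t It /=; rewrite in_itv/= => xyt.
  have [_ dt] : cutoff x y eps t = 0 /\ dcutoff x y eps t = 0.
    apply: cutoff_out; move: eps_gt0 => e0; move/negP: xyt.
    by rewrite negb_and -!ltNge => /orP[?|?]; [left|right]; lra.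
  by rewrite derive1_cutoff dt mulr0.
rewrite (@integral_vanish_outside _ I `]x, y[)//; last first.
- move=> t It /=; rewrite in_itv/= => xyt.
  have [dt _] : cutoff x y eps t = 0 /\ dcutoff x y eps t = 0.
    apply: cutoff_out; move: eps_gt0 => e0; move/negP: xyt.
    by rewrite negb_and -!leNgt => /orP[?|?]; [left|right]; lra.
  by rewrite dt mulr0.
- by apply: subset_trans xyI; exact: subset_itv_oo_cc.
by under eq_integral do rewrite derive1_cutoff.
Qed.

End Cutoff.

(** The weak derivative is tested against trapezoids that fill []x, y[]. The two bumps of [dcutoff]
    concentrate at the ends, where the continuity of [u] gives [u x - u y]; the other side converges
    to the integral of [g] by dominated convergence. *)
Lemma weak_derivative_FTC I u g x y : measurable I -> `[x, y] `<=` I -> x < y ->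
  {within `[x, y], continuous u} -> in_L2 I g -> weak_derivative I u g ->
  \int[mu]_(t in `[x, y]) g t = u y - u x.
Proof.
move=> mI xyI xy cu gL2 ug.
(* The factor 1/4 leaves room for the two margins and the two slopes of the trapezoid. *)
pose e n : R := (y - x) / 4 / n.+1%:R.
have e_gt0 n : 0 < e n by rewrite !divr_gt0// subr_gt0.
have e_le n : 4 * e n <= y - x.
  have : e n <= (y - x) / 4.
    rewrite /e ler_pdivrMr// ler_peMr ?ler1n//.
    by rewrite divr_ge0// subr_ge0 ltW.
  by rewrite ler_pdivlMr// mulrC.
have e_cvg : e n @[n --> \oo] --> 0.
  rewrite -(mulr0 ((y - x) / 4)); apply: cvgM; first exact: cvg_cst.
  exact: cvg_harmonic.
have mg : measurable_fun `]x, y[ g.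
  by apply: measurable_funS gL2.1 => //; apply: subset_trans xyI; exact: subset_itv_oo_cc.
have ig : mu.-integrable `]x, y[ (EFin \o g).
  apply: in_L2_integrable gL2 => //.
    by apply: subset_trans xyI; exact: subset_itv_oo_cc.
  by rewrite /= lebesgue_measure_itv/= lte_fin xy -EFinD ltry.
have gcvg : (\int[mu]_(t in `]x, y[) (g t * cutoff x y (e n) t)%:E)%E @[n --> \oo]
    --> (\int[mu]_(t in `]x, y[) (g t)%:E)%E.
  apply: (@dominated_cvg _ _ _ mu `]x, y[ _ _ _ (fun t => `|g t|%:E)) => //.
  - move=> n; apply/measurable_EFinP; apply: measurable_funM => //.
    apply: measurable_funTS; apply: continuous_measurable_fun => t.
    exact: is_derive_continuous (is_derive_cutoff _ _ _ _).
  - move=> t /=; rewrite in_itv/= => /andP[xt ty].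
    apply: cvg_EFin; first by near=> n.
    rewrite -[X in _ --> X]mulr1; apply: cvgM; first exact: cvg_cst.
    apply: cvg_near_cst.
    (* A point [t] is on the plateau once [2 * e n] is below its distance to both ends. The ends
       themselves are never reached, hence the open interval. *)
    have m_gt0 : 0 < Num.min (t - x) (y - t) / 2.
      by rewrite divr_gt0// lt_min !subr_gt0 xt ty.
    near=> n; apply: cutoff_plateau => //.
    have : e n < Num.min (t - x) (y - t) / 2.
      near: n; exact: (cvgr_lt _ e_cvg).
    by rewrite ltr_pdivlMr// lt_min => /andP[? ?]; apply/andP; split; lra.
  - exact: integrable_abse ig.
  - move=> n t _; rewrite /= lee_fin normrM ler_piMr//.
    exact: normr_cutoff_le1.
have ucvg : (\int[mu]_(t in `[x, y]) (u t * dcutoff x y (e n) t)) @[n --> \oo]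
    --> u x - u y.
  have [_ ux uy] := (continuous_within_itvP _ xy).1 cu.
  apply/cvgrPdist_le => d d0.
  have d20 : 0 < d / 2 by rewrite divr_gt0.
  have /cvgrPdist_le/(_ _ d20)[r1 /= r10 hr1] := ux.
  have /cvgrPdist_le/(_ _ d20)[r2 /= r20 hr2] := uy.
  near=> n.
  have en : 2 * e n < Num.min r1 r2.
    have : e n < Num.min r1 r2 / 2.
      by near: n; apply: (cvgr_lt _ e_cvg); rewrite divr_gt0// lt_min r10 r20.
    by rewrite ltr_pdivlMr// mulrC.
  move: en; rewrite lt_min => /andP[en1 en2].
  have := e_gt0 n; have := e_le n => en4 en0.
  have ib c : mu.-integrable `[x, y] (EFin \o (fun t => u t * bump c (e n) t)).
    apply: within_continuous_integrable => t; apply: cvgM; first exact: cu.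
    by apply: continuous_subspaceT; exact: continuous_bump.
  under eq_Rintegral do rewrite /dcutoff mulrBr.
  rewrite RintegralB//.
  have A1 : `|\int[mu]_(t in `[x, y]) (u t * bump (x + e n) (e n) t) - u x| <= d / 2.
    apply: bump_average => //; [lra|lra|].
    move=> t /andP[t1 t2]; rewrite distrC; apply: hr1 => /=; last lra.
    by rewrite ltr_norml; lra.
  have A2 : `|\int[mu]_(t in `[x, y]) (u t * bump (y - 2 * e n) (e n) t) - u y| <= d / 2.
    apply: bump_average => //; [lra|lra|].
    move=> t /andP[t1 t2]; rewrite distrC; apply: hr2 => /=; last lra.
    by rewrite ltr_norml; lra.
  by move: A1 A2; rewrite !ler_norml => /andP[? ?] /andP[? ?]; lra.
have eqn n : (\int[mu]_(t in `]x, y[) (g t * cutoff x y (e n) t)%:E =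
    (- \int[mu]_(t in `[x, y]) (u t * dcutoff x y (e n) t))%:E)%E.
  have := weak_derivative_cutoff (e_gt0 n) (e_le n) xyI ug => H.
  rewrite EFinN /Rintegral fineK ?H ?oppeK//.
  rewrite -H; apply: integrable_fin_num => //.
  apply: within_continuous_integrable => t; apply: cvgM; first exact: cu.
  by apply: continuous_subspaceT; exact: continuous_dcutoff.
have : (\int[mu]_(t in `]x, y[) (g t)%:E)%E = (u y - u x)%:E.
  apply: (cvg_unique _ gcvg) => //.
  rewrite (funext eqn).
  apply: cvg_EFin; first by near=> n.
  by rewrite -opprB; apply: cvgN.
move=> gE; rewrite /Rintegral integral_itv_bndoo; last exact/measurable_EFinP.
by rewrite gE.
Unshelve. all: by end_near. Qed.

End WeakDerivativeFTC.

(** * Variation of a potential along a function known through its increments *)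

Section ChainRule.
Context {R : realType}.
Notation mu := (@lebesgue_measure R).
Implicit Types (x y s t : R) (u g h f F Phi : R -> R).

Lemma within_continuous_comp_norm (A : set R) u F :
  {within A, continuous u} -> continuous F ->
  {within A, continuous (fun r => F `|u r|)}.
Proof.
move=> cu cF r.
apply: (@continuous_comp (subspace A) R R (fun r => `|u r|) F); last exact: cF.
apply: (@continuous_comp (subspace A) R R u (fun r => `|r|)); first exact: cu.
exact: norm_continuous.
Qed.

Lemma integrable_mul_continuous x y g h : mu.-integrable `[x, y] (EFin \o g) ->
  {within `[x, y], continuous h} ->
  mu.-integrable `[x, y] (EFin \o (fun r => g r * h r)).
Proof.
move=> gi ch; have [M [_ hM]] := compact_bounded
  (continuous_compact ch (@segment_compact _ x y)).
have mh : measurable_fun `[x, y] h by exact: subspace_continuous_measurable_fun.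
have H := @integrableMr _ _ _ mu `[x, y] _ h (EFin \o g) mh.
have : mu.-integrable `[x, y] ((EFin \o h) \* (EFin \o g))%E.
  apply: H => //; exists M; split; first exact: num_real.
  by move=> N MN r xyr /=; apply: (hM N MN); exists r.
by apply: eq_integrable => // r _ /=; rewrite -EFinM mulrC.
Qed.

Lemma Rintegral_itv_split f x s t : x <= s <= t ->
  mu.-integrable `[x, t] (EFin \o f) ->
  \int[mu]_(r in `[x, t]) f r =
  \int[mu]_(r in `[x, s]) f r + \int[mu]_(r in `[s, t]) f r.
Proof.
move=> /andP[xs st] fi.
rewrite -(@Rintegral_itv_obnd_cbnd _ s); last first.
  apply: integrableS fi => //; apply: subset_itv; rewrite bnd_simp//.
by rewrite -(@Rintegral_itvB _ _ _ _ s fi) ?bnd_simp// addrC subrK.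
Qed.

Variables (x y : R) (u g F Phi : R -> R).
Hypothesis (cu : {within `[x, y], continuous u}).
Hypothesis (gi : mu.-integrable `[x, y] (EFin \o g)).
Hypothesis (ug : forall s t, x <= s -> s < t -> t <= y ->
  \int[mu]_(r in `[s, t]) g r = u t - u s).
Hypothesis (cF : continuous F) (F_ge0 : forall r, 0 <= F r).
Hypothesis (dPhi : forall r : R, 0 <= r -> is_derive r (1 : R) Phi (F r)).

Let w r := F `|u r|.

Let cw : {within `[x, y], continuous w}.
Proof.
exact: within_continuous_comp_norm.
Qed.

Let iw eps : mu.-integrable `[x, y] (EFin \o (fun r => `|g r| * (w r + eps))).
Proof.
apply: (@integrable_mul_continuous _ _ (fun r : R => `|g r|)).
  exact: (integrable_norm gi).
by move=> r; apply: cvgD; [exact: cw|exact: cvg_cst].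
Qed.

Let iwS eps s t : x <= s -> t <= y ->
  mu.-integrable `[s, t] (EFin \o (fun r => `|g r| * (w r + eps))).
Proof.
by move=> xs ty; apply: integrableS (iw eps) => //; exact: subset_itv.
Qed.

(** The mean value theorem for [Phi] produces a value between [|u s|] and [|u t|], and the
    intermediate value theorem a time [tau] at which [|u|] takes it. The slope is thus [w tau],
    which exceeds [w0] by at most [eps / 2], while [w0] exceeds [w r] by at most as much: this costs
    [eps] in total. *)
Let local_variation eps w0 s t : x <= s -> s <= t -> t <= y -> 0 <= eps ->
  (forall r, s <= r <= t -> `|w r - w0| <= eps / 2) ->
  `|Phi `|u t| - Phi (`|u s|)| <=
  \int[mu]_(r in `[s, t]) (`|g r| * (w r + eps)).
Proof.
move=> xs st ty e0 we.
have stxy : `[s, t] `<=` `[x, y] by exact: subset_itv.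
have gist : mu.-integrable `[s, t] (EFin \o g) by exact: integrableS gi.
have [tau tau_in Phi_eq] : exists2 tau, s <= tau <= t &
    `|Phi `|u t| - Phi (`|u s|)| = w tau * `|(`|u t|) - (`|u s|)|.
  pose a := Num.min `|u s| `|u t|; pose b := Num.max `|u s| `|u t|.
  have ab : a <= b by rewrite /a /b ge_min le_max !lexx.
  have a0 : 0 <= a by rewrite le_min !normr_ge0.
  have [||c cab Phiab] := @MVT_segment _ Phi F a b ab.
  - by move=> r /itvP rab; apply: dPhi; rewrite (le_trans a0)// rab.
  - apply: derivable_within_continuous => r; rewrite in_itv/= => /andP[ar _].
    by have [] := dPhi (le_trans a0 ar).
  have [||tau] := @IVT R (fun r : R => `|u r|) s t c st.
  - apply: (@within_continuous_comp_norm _ _ id); last by move=> ?; exact: cvg_id.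
    exact: (continuous_subspaceW stxy cu).
  - by move: cab; rewrite in_itv /a /b /=.
  rewrite in_itv/= => tau_in uc; exists tau => //.
  rewrite /w uc; move: Phiab; rewrite /a /b.
  case: (leP `|u s| `|u t|) => H Phiab.
    by rewrite Phiab normrM (ger0_norm (F_ge0 c)).
  by rewrite distrC Phiab normrM [X in _ = _ * X]distrC (ger0_norm (F_ge0 c)).
have [<-|st'] := eqVneq s t.
  rewrite subrr normr0; apply: Rintegral_ge0 => r sr; rewrite mulr_ge0//.
  by rewrite addr_ge0//; exact: F_ge0.
have {}st' : s < t by rewrite lt_neqAle st'.
rewrite Phi_eq.
have ig : mu.-integrable `[s, t] (EFin \o (fun r => `|g r|)) by exact: (integrable_norm gist).
apply: (@le_trans _ _ ((w0 + eps / 2) * \int[mu]_(r in `[s, t]) `|g r|)).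
  have := we _ tau_in; rewrite ler_norml => /andP[w1 w2].
  apply: ler_pM => //; [exact: F_ge0|lra|].
  apply: (le_trans (ler_dist_dist _ _)).
  by rewrite -ug//; exact: le_normr_Rintegral.
rewrite -RintegralZl//; apply: le_Rintegral => //.
- by apply: (@integrableZl _ _ _ _ _ _ (w0 + eps / 2) _ ig).
- exact: iwS.
move=> r; rewrite /= in_itv/= => /we; rewrite ler_norml => /andP[w1 w2].
by rewrite mulrC ler_wpM2l//; lra.
Qed.

(** Continuity induction. The estimate is additive over adjacent intervals, and [local_variation]
    extends it across any interval on which [w] oscillates little. *)
Let variation_eps eps t : x <= t <= y -> 0 < eps ->
  `|Phi `|u t| - Phi (`|u x|)| <=
  \int[mu]_(r in `[x, t]) (`|g r| * (w r + eps)).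
Proof.
move=> /[swap] e0.
pose good t := x <= t <= y /\ `|Phi `|u t| - Phi (`|u x|)| <=
  \int[mu]_(r in `[x, t]) (`|g r| * (w r + eps)).
suff : forall t, x <= t <= y -> good t by move=> H /H[].
have extend s r w0 : good s -> s <= r -> r <= y ->
    (forall q, s <= q <= r -> `|w q - w0| <= eps / 2) -> good r.
  move=> [/andP[xs sy] gs] sr ry we; split; first by rewrite (le_trans xs sr).
  rewrite (@Rintegral_itv_split _ _ s)//; last 2 first.
  - by rewrite xs sr.
  - exact: iwS.
  have := local_variation xs sr ry (ltW e0) we.
  have := ler_distD (Phi `|u s|) (Phi `|u r|) (Phi `|u x|).
  by move: gs; lra.
have loc z : x <= z <= y -> exists2 r, 0 < r & forall q, x <= q <= y ->
    `|q - z| < r -> `|w q - w z| <= eps / 2.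
  move=> zxy; have /subspace_continuousP/(_ z zxy) := cw.
  move=> /cvgrPdist_le/(_ (eps / 2)); rewrite divr_gt0// => /(_ erefl).
  move=> [r /= r0 rw]; exists r => // q qxy qz.
  by rewrite distrC; apply: rw => //=; rewrite distrC.
have goodx : x <= y -> good x.
  move=> xy; split; first by rewrite lexx.
  rewrite subrr normr0; apply: Rintegral_ge0 => r sr; rewrite mulr_ge0//.
  by rewrite addr_ge0 ?(ltW e0)//; exact: F_ge0.
suff goody : x <= y -> forall t, x <= t <= y -> good t.
  by move=> t' t'xy; apply: goody => //; case/andP: t'xy; exact: le_trans.
move=> xy.
(* [A] collects the points up to which the estimate holds. Since [w] is nearly constant around
   [sup A], the estimate passes beyond [sup A], which would be contradictory if a neighbourhood to
   its right were still inside [[x, y]]. *)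
pose A := [set s | x <= s <= y /\ forall r, x <= r <= s -> good r].
have Ax : A x.
  split; first by rewrite lexx.
  move=> r rx; have -> : r = x by apply/eqP; rewrite eq_le andbC.
  exact: goodx.
have supA : has_sup A by split; [exists x|exists y => s [/andP[]]].
have cxy : x <= sup A <= y.
  apply/andP; split; first exact: (ub_le_sup supA.2 Ax).
  by apply: ge_sup; [exists x|move=> s [/andP[]]].
have [r r0 rw] := loc _ cxy.
have [a Aa ca] := sup_adherent r0 supA.
have [axy ga] := Aa.
have ac : a <= sup A by exact: (ub_le_sup supA.2).
case/andP: (axy) => xa ay; case/andP: (cxy) => xc cy.
have past q : x <= q -> q <= y -> q < sup A + r -> good q.
  move=> xq qy qc; have [qa|aq] := leP q a; first by apply: ga; rewrite xq qa.
  apply: (extend a q (w (sup A))) => //; [apply: ga; rewrite xa lexx//|exact: ltW|].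
  move=> p /andP[ap pq]; apply: rw; first by apply/andP; split; lra.
  by rewrite ltr_norml; apply/andP; split; lra.
have ycr : y < sup A + r.
  rewrite ltNge; apply/negP => ry.
  have : A (sup A + r / 2).
    split; first by apply/andP; split; lra.
    by move=> q /andP[xq qr]; apply: past => //; lra.
  by move=> /(ub_le_sup supA.2); lra.
by move=> q /andP[xq qy]; apply: past => //; lra.
Qed.

Lemma chain_variation : x <= y ->
  `|Phi `|u y| - Phi (`|u x|)| <= \int[mu]_(r in `[x, y]) (`|g r| * F `|u r|).
Proof.
move=> xy; apply/ler_addgt0Pr => eps e0.
pose I := \int[mu]_(r in `[x, y]) `|g r|.
have ig : mu.-integrable `[x, y] (EFin \o (fun r => `|g r|)).
  exact: (integrable_norm gi).
have I0 : 0 <= I by apply: Rintegral_ge0.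
(* The excess is [I * d <= eps]; the summand 1 keeps the denominator positive when [I = 0]. *)
pose d := eps / (1 + I).
have d0 : 0 < d by rewrite divr_gt0//; lra.
apply: (le_trans (variation_eps _ d0)); first by rewrite xy lexx.
have iw0 := @integrable_mul_continuous _ _ (fun r : R => `|g r|) w ig cw.
have igd : mu.-integrable `[x, y] (EFin \o (fun r => `|g r| * d)).
  by apply: (@integrable_mul_continuous _ _ (fun r : R => `|g r|)) => // r; exact: cvg_cst.
have -> : \int[mu]_(r in `[x, y]) (`|g r| * (w r + d)) =
    \int[mu]_(r in `[x, y]) (`|g r| * w r) + I * d.
  under eq_Rintegral do rewrite mulrDr.
  by rewrite RintegralD// RintegralZr.
rewrite lerD2l /d mulrA ler_pdivrMr; last lra.
by rewrite mulrDr mulr1 mulrC; lra.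
Qed.

End ChainRule.

(** * Weak derivatives of C^1 functions *)

Section ClassicalDerivative.
Context {R : realType}.
Notation mu := (@lebesgue_measure R).
Implicit Types (I : set R) (x y a b : R) (f g : R -> R).

Variables (u u1 : R -> R).
Hypothesis du : forall x, is_derive x (1 : R) u (u1 x).
Hypothesis cu1 : continuous u1.

Let cu : continuous u.
Proof. by move=> x; exact: is_derive_continuous. Qed.

Lemma weak_derivative_classical I : weak_derivative I u u1.
Proof.
move=> f [df cdf cptf fI].
have f0 x : ~ closure [set x | f x != 0] x -> f x = 0.
  move=> xf; apply/eqP; apply/negPn/negP => fx; apply: xf.
  exact: subset_closure.
have df0 x : ~ closure [set x | f x != 0] x -> derive1 f x = 0.
  move=> xf; rewrite derive1E; rewrite (@near_eq_derive _ _ _ _ (cst 0)).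
  - by rewrite derive_cst.
  - have /open_nbhs_nbhs : open_nbhs x (~` closure [set x | f x != 0]).
      by split => //; apply: closed_openC; exact: closed_closure.
    by apply: filterS => z /f0.
have [M [_ hM]] := compact_bounded cptf.
(* The support lies in [|x| <= |M| + 1], strictly inside [[-b, b]], so the boundary terms of the
   integration by parts vanish. *)
pose b : R := `|M| + 2.
have Mb : M < `|M| + 1 by have := ler_norm M; lra.
have b0 : 0 < b by rewrite /b; have := normr_ge0 M; lra.
have bf x : closure [set x | f x != 0] x -> - b < x < b.
  by move=> /(hM _ Mb) H; rewrite -ltr_norml (le_lt_trans H)// /b ltrD2l ltr1n.
have clo (h : R -> R) : (forall x : R, ~ closure [set x | f x != 0] x -> h x = 0) ->
    (\int[mu]_(x in I) (h x)%:E = \int[mu]_(x in `[(- b)%R, b]) (h x)%:E)%E.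
  move=> h0; rewrite -(@integral_vanish_outside _ setT I)//; last first.
    move=> x _ nIx; rewrite h0// => cx; apply: nIx; exact: interior_subset (fI _ cx).
  rewrite -(@integral_vanish_outside _ setT `[- b, b])//.
  move=> x _ /= nx; rewrite h0// => /bf /andP[x1 x2]; apply: nx.
  by rewrite in_itv/= !ltW.
rewrite !clo.
- rewrite (@integration_by_parts _ u f u1 (derive1 f) (- b) b).
  + have -> : f b = 0 by apply: f0 => /bf; rewrite ltxx andbF.
    have -> : f (- b) = 0 by apply: f0 => /bf; rewrite ltxx.
    by rewrite !mulr0 subrr add0e.
  + by lra.
  + exact: continuous_subspaceT.
  + split; first by move=> x _; case: (du x).
    * by apply: cvg_at_right_filter; exact: cu.
    * by apply: cvg_at_left_filter; exact: cu.
  + by move=> x _; exact: is_derive_derive1.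
  + exact: continuous_subspaceT.
  + have cf x : {for x, continuous f}.
      by apply: differentiable_continuous; exact/derivable1_diffP.
    split; first by move=> x _; exact: df.
    * by apply: cvg_at_right_filter; exact: cf.
    * by apply: cvg_at_left_filter; exact: cf.
  + by [].
- by move=> x xf; rewrite f0// mulr0.
- by move=> x xf; rewrite df0// mulr0.
Qed.

(** Both functions have the increments of [u] as integrals, so [g - u1], extended by zero outside
    [[a, b]], has vanishing integral over every []-oo, y]]. Lebesgue differentiation then makes it
    vanish almost everywhere on the segment. *)
Lemma weak_derivative_ae_eq_segment I g a b : measurable I -> a < b ->
  `[a, b] `<=` I -> in_L2 I g -> weak_derivative I u g ->
  {ae mu, forall x, x \in `[a, b] -> g x = u1 x}.
Proof.
move=> mI ab abI gL2 ug.
have iab : mu.-integrable `[a, b] (EFin \o (fun x => g x - u1 x)).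
  have ig : mu.-integrable `[a, b] (EFin \o g).
    apply: in_L2_integrable gL2 => //.
    by rewrite /= lebesgue_measure_itv/= lte_fin ab -EFinD ltry.
  have iu : mu.-integrable `[a, b] (EFin \o u1).
    by apply: within_continuous_integrable; exact: continuous_subspaceT.
  by have := integrableB _ ig iu; exact.
have int0 y : a < y -> y <= b -> \int[mu]_(x in `[a, y]) (g x - u1 x) = 0.
  move=> ay yb; have ayab : `[a, y] `<=` `[a, b] by exact: subset_itvl.
  rewrite RintegralB//.
  - rewrite (weak_derivative_FTC mI _ ay _ gL2 ug); last 2 first.
    + exact: subset_trans abI.
    + exact: continuous_subspaceT.
    by rewrite (Rintegral_FTC ay cu1 du) subrr.
  - apply: in_L2_integrable gL2 => //; first exact: subset_trans abI.
    by rewrite /= lebesgue_measure_itv/= lte_fin ay -EFinD ltry.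
  - by apply: within_continuous_integrable; exact: continuous_subspaceT.
pose h := (fun x => g x - u1 x) \_ `[a, b].
have ih : mu.-integrable setT (EFin \o h).
  have : mu.-integrable setT ((EFin \o (fun x => g x - u1 x)) \_ `[a, b]).
    by rewrite -integrable_mkcond.
  by rewrite restrict_EFin.
have h0 y : \int[mu]_(x in `]-oo, y]) h x = 0.
  rewrite /h -Rintegral_mkcondr.
  have [ya|ay] := leP y a.
    rewrite /Rintegral (@integral_Sset1 _ _ _ a)//.
    move=> x [] /=; rewrite !in_itv/= => xy /andP[ax _].
    by apply/eqP; rewrite eq_le ax (le_trans xy).
  rewrite (_ : _ `&` _ = [set` `[a, Num.min y b]]); last first.
    rewrite predeqE => x; rewrite /= !in_itv/= le_min; split.
      by move=> [-> /andP[-> ->]].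
    by move=> /and3P[-> -> ->].
  by apply: int0; rewrite ?ge_min ?lexx ?orbT// lt_min ay ab.
have lh := open_integrable_locally (@openT _) ih.
have ihy y : mu.-integrable `]-oo, y] (EFin \o h) by exact: integrableS ih.
have := FTC1Ny ihy lh; apply: filterS; first exact: (ae_filter_ringOfSetsType mu).
move=> x [_].
rewrite (_ : (fun y => _) = cst 0); last by apply/funext.
rewrite derive1_cst /h patchE => + xab; rewrite mem_set// => /esym/eqP.
by rewrite subr_eq0 => /eqP.
Qed.

(** Energies are defined through [wderiv], an arbitrary choice of weak derivative; this lemma lets
    the classical derivative be used in its place. Countably many segments covering [I] leave only a
    null exceptional set. *)
Lemma Lpow2_weak_derivative I g (a b : nat -> R) : measurable I ->
  (forall n, a n < b n) -> I = \bigcup_n `[a n, b n]%classic ->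
  in_L2 I g -> weak_derivative I u g -> Lpow I 2 g = Lpow I 2 u1.
Proof.
move=> mI ab IE gL2 ug; apply: ge0_ae_eq_integral => //.
- have [mg _] := gL2; apply/measurable_EFinP.
  by apply: (measurableT_comp (measurable_powR _)); exact: measurableT_comp.
- apply/measurable_EFinP; apply: measurable_funTS.
  apply: (measurableT_comp (measurable_powR _)); apply: measurableT_comp => //.
  exact: continuous_measurable_fun.
have abI n : `[a n, b n] `<=` I by rewrite IE => x xn; exists n.
have aeE : {ae mu, forall x n, x \in `[a n, b n] -> g x = u1 x}.
  by apply/ae_foralln => n; exact: weak_derivative_ae_eq_segment gL2 ug.
move: aeE; apply: filterS; first exact: (ae_filter_ringOfSetsType mu).
by move=> x H; rewrite {1}IE => -[n _ xn]; rewrite (H n).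
Qed.

Lemma H1_classical I : measurable I -> (Lpow I 2 u < +oo)%E ->
  (Lpow I 2 u1 < +oo)%E -> H1 I u.
Proof.
move=> mI u2 u12; split.
  by split => //; apply: measurable_funTS; exact: continuous_measurable_fun.
exists u1; last exact: weak_derivative_classical.
by split => //; apply: measurable_funTS; exact: continuous_measurable_fun.
Qed.

End ClassicalDerivative.

Lemma wderivP {R : realType} (I : set R) (u : R -> R) : H1 I u ->
  in_L2 I (wderiv I u) /\ weak_derivative I u (wderiv I u).
Proof.
move=> [_ [g gL2 ug]]; rewrite /wderiv.
by case: xgetP => [v _ //|/(_ g)]; case.
Qed.

(** * The calibration *)

Section Action.
Context {R : realType}.
Notation mu := (@lebesgue_measure R).
Implicit Types (x y s t r : R).

(** A functional of Modica-Mortola type, bounded below by the variation of an antiderivative of [F]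
    along [|u|]. *)
Definition action (F : R -> R) (I : set R) (u g : R -> R) : \bar R :=
  (\int[mu]_(x in I) ((g x ^+ 2 + F `|u x| ^+ 2) / 2)%:E)%E.

Variables (I : set R) (u g : R -> R).
Hypothesis mI : measurable I.
Hypothesis I_convex : forall x y, I x -> I y -> `[x, y] `<=` I.
Hypothesis cu : {within I, continuous u}.
Hypothesis (gL2 : in_L2 I g) (ug : weak_derivative I u g).

Lemma measurable_fun_within (F : R -> R) : continuous F ->
  measurable_fun I (fun x => F `|u x|).
Proof.
move=> cF; apply: (measurableT_comp (continuous_measurable_fun cF)).
apply: measurableT_comp => //; exact: subspace_continuous_measurable_fun.
Qed.

Section Calibrated.
Variables (F Phi : R -> R).
Hypothesis (cF : continuous F) (F_ge0 : forall r, 0 <= F r).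
Hypothesis (dPhi : forall r : R, 0 <= r -> is_derive r (1 : R) Phi (F r)).

Lemma measurable_action : measurable_fun I
  (fun x => ((g x ^+ 2 + F `|u x| ^+ 2) / 2)%:E).
Proof.
apply/measurable_EFinP; apply: measurable_funM => //.
apply: measurable_funD; apply: measurable_funX; first exact: gL2.1.
exact: measurable_fun_within.
Qed.

(* AM-GM: |g| F <= (g^2 + F^2) / 2. *)
Lemma variation_le_action s r t : s <= r <= t -> I s -> I t ->
  ((`|Phi (`|u r|) - Phi (`|u s|)| + `|Phi (`|u t|) - Phi (`|u r|)|)%:E
   <= action F I u g)%E.
Proof.
move=> /andP[sr rt] Is It; have stI := I_convex Is It.
have cust : {within `[s, t], continuous u} by exact: continuous_subspaceW cu.
have gist : mu.-integrable `[s, t] (EFin \o g).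
  apply: in_L2_integrable gL2 => //.
  by rewrite /= lebesgue_measure_itv/=; case: ifP => _; rewrite -?EFinD ltry.
have ugst x y : s <= x -> x < y -> y <= t -> \int[mu]_(r in `[x, y]) g r = u y - u x.
  move=> sx xy yt; apply: (weak_derivative_FTC mI _ xy _ gL2 ug).
    by apply: subset_trans stI; exact: subset_itv.
  by apply: continuous_subspaceW cust; exact: subset_itv.
have igF : mu.-integrable `[s, t] (EFin \o (fun x => `|g x| * F `|u x|)).
  apply: (@integrable_mul_continuous _ _ _ (fun x : R => `|g x|)).
    exact: (integrable_norm gist).
  exact: within_continuous_comp_norm.
have V x y : s <= x -> x <= y -> y <= t -> `|Phi (`|u y|) - Phi (`|u x|)| <=
    \int[mu]_(r in `[x, y]) (`|g r| * F `|u r|).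
  move=> sx xy yt; apply: chain_variation => //.
  - by apply: continuous_subspaceW cust; exact: subset_itv.
  - by apply: integrableS gist => //; exact: subset_itv.
  - move=> x' y' xx' x'y' y'y; apply: ugst => //; [exact: le_trans xx'|exact: le_trans yt].
apply: (@le_trans _ _ (\int[mu]_(x in `[s, t]) (`|g x| * F `|u x|)%:E)%E).
  rewrite -[leRHS]fineK; last exact: integrable_fin_num igF.
  rewrite lee_fin -/(Rintegral _ _ _) (@Rintegral_itv_split _ _ _ r)//; last by rewrite sr.
  by apply: lerD; apply: V.
apply: (@le_trans _ _ (\int[mu]_(x in `[s, t]) ((g x ^+ 2 + F `|u x| ^+ 2) / 2)%:E)%E).
  apply: ge0_le_integral => //.
  - by move=> x _; rewrite lee_fin mulr_ge0.
  - exact: measurable_int igF.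
  - by apply: measurable_funS measurable_action.
  - move=> x _; rewrite lee_fin -(real_normK (num_real (g x))).
    have := sqr_ge0 (`|g x| - F `|u x|); nra.
apply: ge0_subset_integral => //; first exact: measurable_action.
by move=> x _; rewrite lee_fin divr_ge0// addr_ge0 ?sqr_ge0.
Qed.

Lemma dist_le_action x y : I x -> I y ->
  (`|Phi (`|u y|) - Phi (`|u x|)|%:E <= action F I u g)%E.
Proof.
wlog xy : x y / x <= y.
  move=> H Ix Iy; case: (leP x y) => [xy|/ltW yx]; first exact: H.
  by rewrite distrC; exact: H.
move=> Ix Iy; have := @variation_le_action x x y.
by rewrite lexx xy subrr normr0 add0r; exact.
Qed.

End Calibrated.

Lemma action_norm_lty : in_L2 I u -> (action Num.norm I u g < +oo)%E.
Proof.
move=> /in_L2_sqr[mu_ u2]; have /in_L2_sqr[mg g2] := gL2.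
rewrite /action.
under eq_integral do rewrite mulrDl EFinD normr_id (real_normK (num_real _)).
have mq (h : R -> R) : measurable_fun I h -> measurable_fun I (fun x => (h x ^+ 2 / 2)%:E).
  move=> mh; apply/measurable_EFinP; apply: measurable_funM => //.
  exact: measurable_funX.
rewrite ge0_integralD//; [|by move=> x _; rewrite lee_fin divr_ge0// sqr_ge0|exact: mq
  |by move=> x _; rewrite lee_fin divr_ge0// sqr_ge0|exact: mq].
have half (h : R -> R) : measurable_fun I h -> (\int[mu]_(x in I) (h x ^+ 2)%:E < +oo)%E ->
    (\int[mu]_(x in I) (h x ^+ 2 / 2)%:E < +oo)%E.
  move=> mh; apply: le_lt_trans; apply: ge0_le_integral => //.
  - by move=> x _; rewrite lee_fin divr_ge0// sqr_ge0.
  - exact: mq.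
  - by apply/measurable_EFinP; exact: measurable_funX.
  - move=> x _; rewrite lee_fin; have := sqr_ge0 (h x); lra.
by rewrite lte_add_pinfty// half.
Qed.

(** The one-dimensional Sobolev embedding is the calibration inequality for [F(s) = |s|] and
    [Phi(s) = s^2 / 2]: the action is then half the squared H^1 norm, and it bounds the oscillation
    of [u^2 / 2]. *)
Lemma bounded_H1 : in_L2 I u -> exists M, forall x, I x -> `|u x| <= M.
Proof.
move=> uL2; have [[x0 Ix0]|none] := pselect (exists x, I x); last first.
  by exists 0 => x Ix; exfalso; apply: none; exists x.
have dPhi (r : R) : 0 <= r -> is_derive r (1 : R) (fun s : R => s ^+ 2 / 2) `|r|.
  move=> r0; rewrite (ger0_norm r0).
  have id_d := is_derive_id r (1 : R).
  have := is_derive_mul (is_derive_mul id_d id_d) (is_derive_cst (2^-1 : R) r 1).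
  by move=> H; apply: (is_derive_val_eq H); rewrite /cst/=; field.
have A := dist_le_action (@norm_continuous _ R) (@normr_ge0 _ R) dPhi Ix0.
have := action_norm_lty uL2; move: A; set a := action _ _ _ _ => A aoo.
have afin : a \is a fin_num.
  rewrite ge0_fin_numE//; apply: integral_ge0 => x _.
  by rewrite lee_fin divr_ge0// addr_ge0// sqr_ge0.
(* The inequality bounds [|u y|^2]; adding 1 bounds [|u y|] without a square root, as
   [t <= 1 + t^2]. *)
exists (1 + `|u x0| ^+ 2 + 2 * fine a) => y Iy.
have := A _ Iy; rewrite -(fineK afin) lee_fin ler_norml => /andP[_].
have := normr_ge0 (u y); have := sqr_ge0 (`|u x0|).
have : 0 <= fine a by rewrite fine_ge0// (le_trans _ (A _ Ix0)).
nra.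
Qed.

Lemma small_value J e : measurable J -> J `<=` I -> mu J = +oo%E -> in_L2 I u ->
  0 < e -> exists2 x, J x & `|u x| < e.
Proof.
move=> mJ JI Joo /in_L2_sqr[mu_ u2] e0; apply/not_exists2P => none.
have : (\int[mu]_(x in J) (e ^+ 2)%:E <= \int[mu]_(x in I) (u x ^+ 2)%:E)%E.
  apply: (@le_trans _ _ (\int[mu]_(x in J) (u x ^+ 2)%:E)%E).
    apply: ge0_le_integral => //.
    - by move=> x _; rewrite lee_fin sqr_ge0.
    - by apply/measurable_EFinP; apply: measurable_funX; exact: measurable_funS mu_.
    - move=> x Jx; rewrite lee_fin -(real_normK (num_real (u x))).
      rewrite ler_sqr ?nnegrE ?(ltW e0)// leNgt; apply/negP => ux.
      by have [|] := none x.
  apply: ge0_subset_integral => //.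
  - by apply/measurable_EFinP; exact: measurable_funX.
  - by move=> x _; rewrite lee_fin sqr_ge0.
rewrite integral_cst// [X in (_ * X)%E]Joo gt0_muley ?lte_fin ?exprn_gt0//.
by rewrite leye_eq => /eqP uE; rewrite uE in u2.
Qed.

End Action.

(** * The slope function, its potential and their scaling *)

Section Antiderivative.
Context {R : realType}.
Notation mu := (@lebesgue_measure R).

Lemma antiderivative_exists (F : R -> R) : continuous F ->
  exists Phi : R -> R, Phi 0 = 0 /\
    forall r : R, 0 <= r -> is_derive r (1 : R) Phi (F r).
Proof.
(* Integrating from -1 makes 0 an interior point, so that the derivative at 0 is two-sided. *)
move=> cF; pose P s := \int[mu]_(t in `[(-1)%R, s]) F t.
exists (fun s => P s - P 0); split; first by rewrite subrr.
move=> r r0; rewrite -[F r]subr0; apply: is_derive_sub.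
have [||||dP PE] := @continuous_FTC1_closed _ F (-1) r (r + 1).
- by rewrite ltrDl ltr01.
- by apply: within_continuous_integrable; exact: continuous_subspaceT.
- by rewrite (lt_le_trans _ r0)// ltrN10.
- exact: cF.
by split; [exact: dP|rewrite -derive1E; exact: PE].
Qed.

Lemma continuous_powR_norm (a : R) : 0 < a -> continuous (fun s : R => `|s| `^ a).
Proof.
move=> a0 s; have [->|s0] := eqVneq s 0.
  apply/cvgrPdist_le => e e0; rewrite normr0 powR0 ?gt_eqF//.
  have d0 : 0 < e `^ a^-1 by rewrite powR_gt0.
  exists (e `^ a^-1) => //= t; rewrite /= !sub0r !normrN => te.
  rewrite ger0_norm ?powR_ge0//.
  have : `|t| `^ a <= (e `^ a^-1) `^ a.
    by rewrite ge0_ler_powR ?nnegrE ?powR_ge0 ?(ltW a0) ?(ltW te).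
  by rewrite -powRrM mulVf ?gt_eqF// powRr1// ltW.
have s1 : 0 < `|s| by rewrite normr_gt0.
apply: (@continuous_comp _ _ _ (fun s : R => `|s|) (fun r => r `^ a)).
  exact: norm_continuous.
exact: is_derive_continuous (is_derive1_powR a s1).
Qed.

End Antiderivative.

Section Calibration.
Context {R : realType}.
Variable p : R.
Hypothesis p_gt2 : 2 < p.
Implicit Types (lam s r : R).

(** [Num.sqrt] is 0 on negative numbers, so this is continuous and nonnegative on the whole line and
    vanishes beyond [peak1]; the identity for its square is therefore restricted to
    [|s| <= peak1]. *)
Definition slope1 s : R := `|s| * Num.sqrt (1 - 2 / p * `|s| `^ (p - 2)).

Lemma slope1_ge0 s : 0 <= slope1 s.
Proof. by rewrite mulr_ge0// sqrtr_ge0. Qed.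

Lemma continuous_slope1 : continuous slope1.
Proof.
move=> s; apply: cvgM; first exact: norm_continuous.
apply: (@continuous_comp _ _ _ (fun s => 1 - 2 / p * `|s| `^ (p - 2)) Num.sqrt).
  apply: cvgB; first exact: cvg_cst.
  apply: cvgM; first exact: cvg_cst.
  by apply: continuous_powR_norm; rewrite subr_gt0.
exact: sqrt_continuous.
Qed.

(** The positive zero of the radicand in [slope1], and the maximum of the soliton at scale 1. *)
Definition peak1 : R := (p / 2) `^ (p - 2)^-1.

Lemma peak1_gt0 : 0 < peak1.
Proof. by rewrite powR_gt0// divr_gt0// (lt_trans _ p_gt2). Qed.

Lemma peak1_powR : peak1 `^ (p - 2) = p / 2.
Proof.
have p2 : p - 2 != 0 by rewrite subr_eq0 gt_eqF.
by rewrite /peak1 -powRrM mulVf// powRr1// divr_ge0// ltW// (lt_trans _ p_gt2).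
Qed.

Lemma powR_p s : `|s| `^ p = s ^+ 2 * `|s| `^ (p - 2).
Proof.
have [->|s0] := eqVneq s 0.
  by rewrite normr0 powR0 ?expr0n ?mul0r// gt_eqF// (lt_trans _ p_gt2).
rewrite -(real_normK (num_real s)) -powR_mulrn// -powRD ?normr_eq0 ?s0 ?implybT//.
by rewrite addrC subrK.
Qed.

Lemma slope1_sqr s : `|s| <= peak1 -> slope1 s ^+ 2 = s ^+ 2 - 2 / p * `|s| `^ p.
Proof.
move=> sM; have p0 : 0 < p by rewrite (lt_trans _ p_gt2).
rewrite /slope1 exprMn sqr_sqrtr; last first.
  have : `|s| `^ (p - 2) <= p / 2.
    rewrite -peak1_powR ge0_ler_powR ?nnegrE ?subr_ge0//; first exact: ltW.
    exact: ltW peak1_gt0.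
  rewrite -(ler_pM2l (divr_gt0 (ltr0n _ 2) p0)) => /le_trans H.
  by rewrite subr_ge0; apply: H; rewrite mulrA divfK ?gt_eqF// divff.
by rewrite powR_p real_normK ?num_real//; ring.
Qed.

Definition potential1 : R -> R := sval (cid (antiderivative_exists continuous_slope1)).

Lemma potential10 : potential1 0 = 0.
Proof. by rewrite /potential1; case: cid => P []. Qed.

Lemma is_derive_potential1 r : 0 <= r -> is_derive r (1 : R) potential1 (slope1 r).
Proof. have [_ dP] := svalP (cid (antiderivative_exists continuous_slope1)); exact: dP. Qed.

Lemma potential1_peak_gt0 : 0 < potential1 peak1.
Proof.
have M0 := peak1_gt0; have p0 : 0 < p by rewrite (lt_trans _ p_gt2).
have [||c] := @MVT _ potential1 slope1 0 peak1 M0.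
- by move=> x /itvP x0M; apply: is_derive_potential1; rewrite x0M.
- apply: derivable_within_continuous => r; rewrite in_itv/= => /andP[r0 _].
  by have [] := is_derive_potential1 r0.
rewrite in_itv/= potential10 !subr0 => /andP[c0 cM] ->.
rewrite mulr_gt0// mulr_gt0 ?normr_gt0 ?gt_eqF// sqrtr_gt0 subr_gt0.
have : c `^ (p - 2) < p / 2.
  by rewrite -peak1_powR gt0_ltr_powR ?nnegrE ?ltW// subr_gt0.
rewrite (gtr0_norm c0) -(ltr_pM2l (divr_gt0 (ltr0n _ 2) p0)) => /lt_le_trans; apply.
by rewrite mulrA divfK ?gt_eqF// divff.
Qed.

(** The exponents follow from the scaling [lam * phi (k x)] with [k = lam^((p-2)/2)]: slopes are
    multiplied by [lam * k = lam^(p/2)], and integration in [s] contributes one more factor [lam] to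
    the potential. *)
Definition slope lam s : R := lam `^ (p / 2) * slope1 (s / lam).
Definition potential lam s : R := lam `^ (p / 2 + 1) * potential1 (s / lam).

Lemma slope_ge0 lam s : 0 <= slope lam s.
Proof. by rewrite mulr_ge0 ?powR_ge0 ?slope1_ge0. Qed.

Lemma continuous_slope lam : continuous (slope lam).
Proof.
move=> s; apply: cvgM; first exact: cvg_cst.
apply: (@continuous_comp _ _ _ (fun s => s / lam) slope1); last exact: continuous_slope1.
by apply: cvgM; [exact: cvg_id|exact: cvg_cst].
Qed.

Lemma potential0 lam : potential lam 0 = 0.
Proof. by rewrite /potential mul0r potential10 mulr0. Qed.

Lemma is_derive_potential lam r : 0 < lam -> 0 <= r ->
  is_derive r (1 : R) (potential lam) (slope lam r).
Proof.
move=> l0 r0; have rl : 0 <= r / lam by rewrite divr_ge0// ltW.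
have dl : is_derive r (1 : R) (fun s : R => s / lam) lam^-1.
  have H := is_derive_mul (is_derive_id r (1 : R)) (is_derive_cst (lam^-1 : R) r 1).
  by apply: (is_derive_val_eq H); rewrite /cst/= mul1r mulr0 addr0.
have H := is_derive_scale (lam `^ (p / 2 + 1))
  (@is_derive_comp _ potential1 (fun s => s / lam) _ _ _ (is_derive_potential1 rl) dl).
have lE : lam `^ (p / 2 + 1) = lam `^ (p / 2) * lam.
  by rewrite powRD ?(gt_eqF l0) ?implybT// powRr1// ltW.
apply: (is_derive_val_eq H); rewrite lE /slope; field; exact: lt0r_neq0.
Qed.

Lemma slope_sqr lam s : 0 < lam -> `|s| <= lam * peak1 ->
  slope lam s ^+ 2 = lam `^ (p - 2) * s ^+ 2 - 2 / p * `|s| `^ p.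
Proof.
move=> l0 sM; have l_ge0 := ltW l0.
have lp : lam `^ (p / 2) ^+ 2 = lam `^ p.
  by rewrite -powR_mulrn ?powR_ge0// -powRrM divfK.
have slE : `|s / lam| = `|s| / lam by rewrite normrM normfV (gtr0_norm l0).
rewrite /slope exprMn lp slope1_sqr; last first.
  by rewrite slE ler_pdivrMr// mulrC.
have lV : lam^-1 `^ p = (lam `^ p)^-1.
  by rewrite -powR_inv1// -powRrM mulN1r powRN.
rewrite slE powRM ?invr_ge0// lV.
have -> : lam `^ p = lam `^ (p - 2) * lam ^+ 2.
  by rewrite -powR_mulrn// -powRD ?(gt_eqF l0) ?implybT// subrK.
have : lam `^ (p - 2) != 0 by rewrite gt_eqF// powR_gt0.
have := lt0r_neq0 l0; have : p != 0 by rewrite gt_eqF// (lt_trans _ p_gt2).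
by move=> ? ? ?; field; do ?[apply/andP; split].
Qed.

End Calibration.

(** * The soliton *)

Section Profile.
Context {R : realType}.
Variable p : R.
Hypothesis p_gt2 : 2 < p.
Implicit Types (lam x y : R).

Let p0 : 0 < p. Proof. by rewrite (lt_trans _ p_gt2). Qed.
Let q0 : 0 < p - 2. Proof. by rewrite subr_gt0. Qed.

(* [tanh ((p - 2) x / 2)] *)
Definition tanh_p x : R := 1 - 2 / (1 + expR ((p - 2) * x)).

Let e1 x : 0 < 1 + expR ((p - 2) * x).
Proof. by rewrite addr_gt0// expR_gt0. Qed.

Lemma tanh_p_sqr x : 1 - tanh_p x ^+ 2 =
  4 * expR ((p - 2) * x) / (1 + expR ((p - 2) * x)) ^+ 2.
Proof. by rewrite /tanh_p; field; rewrite gt_eqF. Qed.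

Lemma tanh_p_sqr_lt1 x : 0 < 1 - tanh_p x ^+ 2.
Proof. by rewrite tanh_p_sqr divr_gt0 ?exprn_gt0// mulr_gt0// expR_gt0. Qed.

Lemma tanh_pN x : tanh_p (- x) = - tanh_p x.
Proof.
rewrite /tanh_p mulrN expRN; field.
by rewrite !gt_eqF ?expR_gt0// addrC.
Qed.

Lemma tanh_p0 : tanh_p 0 = 0.
Proof. by rewrite /tanh_p mulr0 expR0 -natr1 divff ?subrr// natr1. Qed.

Lemma tanh_p_le x y : x <= y -> tanh_p x <= tanh_p y.
Proof.
move=> xy; rewrite /tanh_p lerD2l lerN2 ler_pM2l// lef_pV2 ?posrE//.
by rewrite lerD2l ler_expR ler_pM2l.
Qed.

Lemma tanh_p_ge0 x : 0 <= x -> 0 <= tanh_p x.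
Proof. by move=> /tanh_p_le; rewrite tanh_p0. Qed.

Lemma is_derive_tanh_p x :
  is_derive x (1 : R) tanh_p ((p - 2) / 2 * (1 - tanh_p x ^+ 2)).
Proof.
have dl := is_derive_affine (p - 2) 0 x.
have de : is_derive x (1 : R) (fun x => expR ((p - 2) * (x - 0)))
    (expR ((p - 2) * (x - 0)) * (p - 2)).
  exact: (@is_derive_comp _ expR (fun x => (p - 2) * (x - 0)) _ _ _ (is_derive_expR _) dl).
have d1 := is_derive_add (is_derive_cst (1 : R) x 1) de.
have nz : cst 1 x + expR ((p - 2) * (x - 0)) != 0 :> R.
  by rewrite /cst subr0 gt_eqF.
have dV := @is_deriveV _ (fun t => cst 1 t + expR ((p - 2) * (t - 0))) _ _ _ nz d1.
have H := is_derive_sub (is_derive_cst (1 : R) x 1) (is_derive_scale 2 dV).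
rewrite (_ : tanh_p = (fun x => cst 1 x - 2 * (cst 1 x + expR ((p - 2) * (x - 0)))^-1)).
  apply: (is_derive_val_eq H).
  rewrite tanh_p_sqr /cst /GRing.scale/= subr0; field.
  by rewrite gt_eqF.
by apply/funext => z; rewrite /tanh_p /cst subr0.
Qed.

(** Since [1 - tanh^2 = sech^2], this is the soliton shape [C * sech (c x)^(2/(p-2))] with
    [c = (p - 2) / 2], at frequency 1. *)
Definition profile1 x : R := (p / 2 * (1 - tanh_p x ^+ 2)) `^ (p - 2)^-1.

Let base_gt0 x : 0 < p / 2 * (1 - tanh_p x ^+ 2).
Proof. by rewrite mulr_gt0 ?divr_gt0// tanh_p_sqr_lt1. Qed.

Lemma profile1_gt0 x : 0 < profile1 x.
Proof. by rewrite powR_gt0. Qed.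

Lemma profile1_powR x : profile1 x `^ (p - 2) = p / 2 * (1 - tanh_p x ^+ 2).
Proof. by rewrite /profile1 -powRrM mulVf ?gt_eqF// powRr1// ltW. Qed.

Lemma profile1N x : profile1 (- x) = profile1 x.
Proof. by rewrite /profile1 tanh_pN sqrrN. Qed.

Lemma profile10 : profile1 0 = peak1 p.
Proof. by rewrite /profile1 tanh_p0 expr0n subr0 mulr1. Qed.

Lemma profile1_le x y : `|x| <= `|y| -> profile1 y <= profile1 x.
Proof.
have abs z : profile1 z = profile1 `|z|.
  by case: (ger0P z) => _; [reflexivity|rewrite profile1N].
rewrite (abs x) (abs y) => xy; rewrite /profile1 ge0_ler_powR ?nnegrE ?(ltW (base_gt0 _))//.
  by rewrite invr_ge0 ltW.
rewrite ler_pM2l ?divr_gt0// lerD2l lerN2 ler_sqr ?nnegrE ?tanh_p_ge0//.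
exact: tanh_p_le.
Qed.

Lemma is_derive_profile1 x :
  is_derive x (1 : R) profile1 (- tanh_p x * profile1 x).
Proof.
have dT := is_derive_tanh_p x.
have dB := is_derive_scale (p / 2) (is_derive_sub (is_derive_cst (1 : R) x 1)
  (is_derive_mul dT dT)).
have dP : is_derive (p / 2 * (cst 1 x - tanh_p x * tanh_p x)) (1 : R)
    (fun t => t `^ (p - 2)^-1)
    ((p - 2)^-1 * (p / 2 * (cst 1 x - tanh_p x * tanh_p x)) `^ ((p - 2)^-1 - 1)).
  by apply: is_derive1_powR; rewrite /cst -expr2.
have H := @is_derive_comp _ (fun t => t `^ (p - 2)^-1)
  (fun t => p / 2 * (cst 1 t - tanh_p t * tanh_p t)) _ _ _ dP dB.
rewrite (_ : profile1 = (fun x => (p / 2 * (cst 1 x - tanh_p x * tanh_p x)) `^ (p - 2)^-1)).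
  apply: (is_derive_val_eq H).
  rewrite /cst -expr2; have b0 := base_gt0 x.
  rewrite powRB; last by rewrite (gt_eqF b0) implybT.
  rewrite (powRr1 (ltW b0)); set B := _ `^ _.
  move: b0 (tanh_p_sqr_lt1 x); set T := tanh_p x => b0 T1.
  by field; rewrite !gt_eqF.
by apply/funext => z; rewrite /profile1 /cst expr2.
Qed.

(** With [T = tanh_p x], the radicand is [1 - (1 - T^2) = T^2]. Since the derivative of the profile
    is [- T] times the profile, this is the first integral [|phi'| = F(phi)]. *)
Lemma slope1_profile1 x : slope1 p (profile1 x) = `|tanh_p x| * profile1 x.
Proof.
rewrite /slope1 (gtr0_norm (profile1_gt0 x)) profile1_powR mulrC; congr (_ * _).
rewrite -sqrtr_sqr; congr Num.sqrt; field.
by rewrite gt_eqF.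
Qed.

(** With [e = expR ((p - 2) * x)], one has [1 - tanh_p x ^+ 2 = 4 e / (1 + e)^2 <= 4 / e];
    multiplying by [p / 2] gives the constant [2 * p]. *)
Lemma profile1_le_exp x : profile1 x <= (2 * p) `^ (p - 2)^-1 * expR (- x).
Proof.
have -> : expR (- x) = (expR (- ((p - 2) * x))) `^ (p - 2)^-1.
  by rewrite -expRM; congr expR; field; rewrite gt_eqF.
have p2_ge0 : 0 <= 2 * p by rewrite mulr_ge0// ltW.
have q_ge0 : 0 <= (p - 2)^-1 by rewrite invr_ge0 ltW.
rewrite -powRM ?expR_ge0// /profile1.
rewrite ge0_ler_powR ?nnegrE ?(ltW (base_gt0 _)) ?(mulr_ge0 p2_ge0) ?expR_ge0//.
rewrite tanh_p_sqr expRN; have := e1 x; have := expR_gt0 ((p - 2) * x).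
move: (expR _) => e e0 ee.
rewrite -subr_ge0.
have -> : 2 * p * e^-1 - p / 2 * (4 * e / (1 + e) ^+ 2) =
    2 * p * (1 + 2 * e) / (e * (1 + e) ^+ 2).
  by field; rewrite !gt_eqF.
by rewrite divr_ge0 ?mulr_ge0 ?sqr_ge0 ?addr_ge0 ?mulr_ge0// ltW.
Qed.

Lemma profile1_cvg0 : profile1 x @[x --> +oo] --> (0 : R).
Proof.
have E : (2 * p) `^ (p - 2)^-1 * expR (- x) @[x --> +oo] --> (0 : R).
  rewrite -[X in _ --> X](mulr0 ((2 * p) `^ (p - 2)^-1)).
  by apply: cvgM; [exact: cvg_cst|exact: cvgr_expR].
apply: (squeeze_cvgr _ (cvg_cst 0) E).
by near=> x; rewrite (ltW (profile1_gt0 _)) profile1_le_exp.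
Unshelve. all: by end_near. Qed.

End Profile.

Lemma continuous_sqr_comp {R : realType} (f : R -> R) : continuous f ->
  continuous (fun x => f x ^+ 2).
Proof.
move=> cf x; apply: (@continuous_comp _ _ _ f (fun y => y ^+ 2)); first exact: cf.
exact: exprn_continuous.
Qed.

(** * Mass and energy of the soliton at scale [lam] *)

Section SechSoliton.
Context {R : realType}.
Notation mu := (@lebesgue_measure R).
Variables (p lam : R).
Hypotheses (p_gt2 : 2 < p) (lam_gt0 : 0 < lam).
Implicit Types (x y : R).

Let p0 : 0 < p. Proof. by rewrite (lt_trans _ p_gt2). Qed.
Let q0 : 0 < p - 2. Proof. by rewrite subr_gt0. Qed.

(** The square root of the frequency [w = lam^(p-2)]. *)
Definition wavenumber : R := lam `^ ((p - 2) / 2).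
Local Notation k := wavenumber.

Lemma wavenumber_gt0 : 0 < k. Proof. by rewrite powR_gt0. Qed.
Let k0 := wavenumber_gt0.

Lemma wavenumber_sqr : k ^+ 2 = lam `^ (p - 2).
Proof. by rewrite /wavenumber -powR_mulrn ?powR_ge0// -powRrM divfK. Qed.

Definition sech_soliton x : R := lam * profile1 p (k * x).
Definition dsech_soliton x : R := - (k * tanh_p p (k * x)) * sech_soliton x.
Local Notation phi := sech_soliton.
Local Notation dphi := dsech_soliton.

Lemma sech_soliton_gt0 x : 0 < phi x.
Proof. by rewrite mulr_gt0// profile1_gt0. Qed.

Lemma sech_solitonN x : phi (- x) = phi x.
Proof. by rewrite /sech_soliton mulrN profile1N. Qed.

Lemma dsech_solitonN x : dphi (- x) = - dphi x.
Proof.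
by rewrite /dsech_soliton sech_solitonN mulrN tanh_pN mulrN mulNr.
Qed.

Lemma sech_soliton0 : phi 0 = lam * peak1 p.
Proof. by rewrite /sech_soliton mulr0 profile10. Qed.

Lemma sech_soliton_le x y : `|x| <= `|y| -> phi y <= phi x.
Proof.
move=> xy; rewrite (ler_pM2l lam_gt0); apply: (profile1_le p_gt2).
by rewrite !normrM; apply: ler_wpM2l.
Qed.

Lemma sech_soliton_le_peak x : phi x <= lam * peak1 p.
Proof. by rewrite -sech_soliton0 sech_soliton_le// normr0. Qed.

Let dkx x : is_derive x (1 : R) (fun x => k * x) k.
Proof.
have H := is_derive_scale k (is_derive_id x (1 : R)).
by apply: (is_derive_val_eq H); rewrite mulr1.
Qed.

Lemma is_derive_sech_soliton x : is_derive x (1 : R) phi (dphi x).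
Proof.
have H := is_derive_scale lam (@is_derive_comp _ (profile1 p) (fun x => k * x) x _ _
  (is_derive_profile1 p_gt2 _) (dkx x)).
by apply: (is_derive_val_eq H); rewrite /dsech_soliton /sech_soliton; ring.
Qed.

Definition ddsech_soliton x : R :=
  - (k * ((p - 2) / 2 * (1 - tanh_p p (k * x) ^+ 2) * k)) * phi x
  + - (k * tanh_p p (k * x)) * dphi x.

Lemma is_derive_dsech_soliton x : is_derive x (1 : R) dphi (ddsech_soliton x).
Proof.
have dT := is_derive_scale k (@is_derive_comp _ (tanh_p p) (fun x => k * x) x _ _
  (is_derive_tanh_p _ _) (dkx x)).
exact: (is_derive_mul (is_derive_opp dT) (is_derive_sech_soliton x)).
Qed.

Lemma continuous_sech_soliton : continuous phi.
Proof. by move=> x; exact: is_derive_continuous (is_derive_sech_soliton x). Qed.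

Lemma continuous_dsech_soliton : continuous dphi.
Proof. by move=> x; exact: is_derive_continuous (is_derive_dsech_soliton x). Qed.

Lemma tanh_p_norm_le1 (x : R) : `|tanh_p p x| <= 1.
Proof.
have : tanh_p p x ^+ 2 <= 1 by have := tanh_p_sqr_lt1 p x; lra.
by move=> T1; rewrite -(@expr_le1 _ 2)// real_normK ?num_real.
Qed.

Lemma dsech_soliton_le x : `|dphi x| <= k * phi x.
Proof.
rewrite /dsech_soliton normrM normrN normrM (gtr0_norm k0).
rewrite (gtr0_norm (sech_soliton_gt0 x)) ler_wpM2r ?(ltW (sech_soliton_gt0 x))//.
by rewrite ler_piMr ?tanh_p_norm_le1// ltW.
Qed.

Lemma slope_sech_soliton x : slope p lam (phi x) = `|dphi x|.
Proof.
rewrite /slope /dsech_soliton {1}/sech_soliton mulrAC divff ?gt_eqF// mul1r.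
rewrite slope1_profile1// !normrM normrN normrM (gtr0_norm k0) (gtr0_norm lam_gt0).
rewrite (gtr0_norm (profile1_gt0 p_gt2 _)).
have -> : lam `^ (p / 2) = k * lam.
  rewrite /wavenumber -[X in _ = _ * X]powRr1 ?(ltW lam_gt0)//.
  rewrite -powRD ?(gt_eqF lam_gt0) ?implybT//; congr (_ `^ _); by field.
by ring.
Qed.

Lemma sech_soliton_powR x :
  `|phi x| `^ p = p / 2 * (k ^+ 2 * phi x ^+ 2 - dphi x ^+ 2).
Proof.
have := slope_sqr p_gt2 lam_gt0 (s := phi x).
rewrite (gtr0_norm (sech_soliton_gt0 x)) => /(_ (sech_soliton_le_peak x)).
rewrite slope_sech_soliton real_normK ?num_real// -wavenumber_sqr => ->.
by field; rewrite gt_eqF.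
Qed.

Lemma sech_soliton_cvg0 : phi x @[x --> +oo] --> (0 : R).
Proof.
rewrite -[X in _ --> X](mulr0 lam); apply: cvgM; first exact: cvg_cst.
apply: (@cvg_comp _ _ _ (fun x => k * x) (profile1 p) _ (@pinfty_nbhs R)).
  exact: gt0_cvgMry.
exact: profile1_cvg0.
Qed.


Lemma dsech_soliton_cvg0 : dphi x @[x --> +oo] --> (0 : R).
Proof.
have kphi : k * phi x @[x --> +oo] --> (0 : R).
  by rewrite -(mulr0 k); apply: cvgM; [exact: cvg_cst|exact: sech_soliton_cvg0].
have Nkphi : - (k * phi x) @[x --> +oo] --> (0 : R).
  by rewrite -oppr0; exact: cvgN.
apply: (squeeze_cvgr _ Nkphi kphi).
by near=> x; rewrite -ler_norml dsech_soliton_le.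
Unshelve. all: by end_near. Qed.

Lemma potential_sech_soliton_cvg0 :
  potential p_gt2 lam (phi x) @[x --> +oo] --> (0 : R).
Proof.
rewrite -[X in _ --> X](potential0 p_gt2 lam).
have c0 : {for 0, continuous (potential p_gt2 lam)}.
  exact: is_derive_continuous (is_derive_potential p_gt2 lam_gt0 (lexx 0)).
exact: (@cvg_comp _ _ _ phi (potential p_gt2 lam) _ _ _ sech_soliton_cvg0 c0).
Qed.

Lemma dsech_soliton_le0 x : 0 <= x -> dphi x <= 0.
Proof.
move=> x0; rewrite /dsech_soliton mulNr oppr_le0 mulr_ge0//.
  by rewrite mulr_ge0 ?tanh_p_ge0 ?mulr_ge0// ltW.
exact: ltW (sech_soliton_gt0 x).
Qed.

(** This is [Phi(M)] for the peak [M = lam * peak1 p]. The mass, the kinetic term and the energy of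
    the soliton are all expressed through it. *)
Definition peak_action : R := lam `^ (p / 2 + 1) * potential1 p_gt2 (peak1 p).

Lemma potential_peak : potential p_gt2 lam (lam * peak1 p) = peak_action.
Proof. by rewrite /potential mulrAC divff ?mul1r// gt_eqF. Qed.

Lemma is_derive_potential_sech_soliton x : is_derive x (1 : R)
  (fun x => potential p_gt2 lam (phi x)) (`|dphi x| * dphi x).
Proof.
rewrite -slope_sech_soliton.
apply: (@is_derive_comp _ (potential p_gt2 lam) phi).
  exact: (is_derive_potential p_gt2 lam_gt0 (ltW (sech_soliton_gt0 x))).
exact: is_derive_sech_soliton.
Qed.

Lemma halfline_FTC (f F : R -> R) : continuous f -> (forall x, 0 <= f x) ->
  (forall x, 0 <= x -> is_derive x (1 : R) F (f x)) ->
  F x @[x --> +oo] --> (0 : R) ->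
  (\int[mu]_(x in `[0%R, +oo[) (f x)%:E = (- F 0)%:E)%E.
Proof.
move=> cf f0 dF Foo; rewrite (@ge0_continuous_FTC2y _ f F 0 0)//.
- by rewrite add0e.
- exact: continuous_subspaceT.
- by move=> x /ltW /dF[].
- apply: cvg_at_right_filter; exact: is_derive_continuous (dF 0 (lexx 0)).
- move=> x; rewrite in_itv/= andbT => /ltW x0; exact: is_derive_derive1 (dF _ x0).
Qed.

(** For [x >= 0] the soliton decreases, so [phi'^2 = - F(phi) phi'] is the derivative of
    [- Phi(phi)]. The integral is computed without any explicit formula for [Phi]. *)
Lemma integral_dsech_soliton_sqr :
  (\int[mu]_(x in `[0%R, +oo[) (dphi x ^+ 2)%:E = peak_action%:E)%E.
Proof.
have cf : continuous (fun x => dphi x ^+ 2).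
  by exact: (continuous_sqr_comp continuous_dsech_soliton).
have dF x : 0 <= x ->
    is_derive x (1 : R) (fun x => - potential p_gt2 lam (phi x)) (dphi x ^+ 2).
  move=> x0; have H := is_derive_opp (is_derive_potential_sech_soliton x).
  by apply: (is_derive_val_eq H); rewrite ler0_norm ?dsech_soliton_le0// mulNr opprK expr2.
have Foo : - potential p_gt2 lam (phi x) @[x --> +oo] --> (0 : R).
  by rewrite -[X in _ --> X]oppr0; apply: cvgN; exact: potential_sech_soliton_cvg0.
have -> := halfline_FTC cf (fun x => sqr_ge0 (dphi x)) dF Foo.
by rewrite opprK sech_soliton0 potential_peak.
Qed.

(* Pohozaev identity: [2 (phi phi')' = (p + 2) phi'^2 - (p - 2) k^2 phi^2]. *)
Lemma integral_sech_soliton_sqr :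
  (\int[mu]_(x in `[0%R, +oo[) (phi x ^+ 2)%:E =
   ((p + 2) / ((p - 2) * k ^+ 2) * peak_action)%:E)%E.
Proof.
pose c := ((p - 2) * k ^+ 2)^-1.
have k2 : 0 < k ^+ 2 by rewrite exprn_gt0.
(* The antiderivative obtained by solving the identity for [phi^2], with [- Phi(phi)] as
   antiderivative of [phi'^2] on the half-line. *)
pose P x := c * (- ((p + 2) * potential p_gt2 lam (phi x)) - 2 * (phi x * dphi x)).
have cf : continuous (fun x => phi x ^+ 2).
  by exact: (continuous_sqr_comp continuous_sech_soliton).
have dP x : 0 <= x -> is_derive x (1 : R) P (phi x ^+ 2).
  move=> x0; have H := is_derive_scale c (is_derive_sub
    (is_derive_opp (is_derive_scale (p + 2) (is_derive_potential_sech_soliton x)))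
    (is_derive_scale 2 (is_derive_mul (is_derive_sech_soliton x)
       (is_derive_dsech_soliton x)))).
  apply: (is_derive_val_eq H); rewrite ler0_norm ?dsech_soliton_le0//.
  rewrite /ddsech_soliton /dsech_soliton /c; field.
  by rewrite !gt_eqF.
have Poo : P x @[x --> +oo] --> (0 : R).
  rewrite -[X in _ --> X](mulr0 c); apply: cvgM; first exact: cvg_cst.
  rewrite -[X in _ --> X]subr0; apply: cvgB.
    rewrite -[X in _ --> X]oppr0; apply: cvgN.
    rewrite -[X in _ --> X](mulr0 (p + 2)); apply: cvgM; first exact: cvg_cst.
    exact: potential_sech_soliton_cvg0.
  rewrite -[X in _ --> X](mulr0 2); apply: cvgM; first exact: cvg_cst.
  rewrite -[X in _ --> X](mulr0 0); apply: cvgM; first exact: sech_soliton_cvg0.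
  exact: dsech_soliton_cvg0.
have -> := halfline_FTC cf (fun x => sqr_ge0 (phi x)) dP Poo.
congr EFin; rewrite /P sech_soliton0 potential_peak /dsech_soliton mulr0 tanh_p0.
by rewrite /c; field; rewrite !gt_eqF.
Qed.

Definition soliton_mass : R := 2 * (p + 2) / (p - 2) * peak_action / lam `^ (p - 2).

Let even_integral (f : R -> R) c : continuous f -> (forall x, 0 <= f x) ->
  (forall x, f (- x) = f x) ->
  (\int[mu]_(x in `[0%R, +oo[) (f x)%:E = c%:E)%E ->
  (\int[mu]_x (f x)%:E = (2 * c)%:E)%E.
Proof.
move=> cf f0 fN fc; rewrite ge0_symfun_integralT//; last by move=> x; rewrite /= fN.
by rewrite -set_itvcy fc.
Qed.

Lemma Lpow2_sech_soliton : Lpow setT 2 phi = soliton_mass%:E.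
Proof.
rewrite /Lpow; under eq_integral do rewrite powR2_sqr.
rewrite (@even_integral (fun x => phi x ^+ 2) _ _ _ _ integral_sech_soliton_sqr).
- rewrite /soliton_mass -wavenumber_sqr; congr EFin; field.
  by rewrite !gt_eqF// exprn_gt0.
- by exact: (continuous_sqr_comp continuous_sech_soliton).
- by move=> x; rewrite sqr_ge0.
- by move=> x; rewrite sech_solitonN.
Qed.

Lemma Lpow2_dsech_soliton : Lpow setT 2 dphi = (2 * peak_action)%:E.
Proof.
rewrite /Lpow; under eq_integral do rewrite powR2_sqr.
rewrite (@even_integral (fun x => dphi x ^+ 2) _ _ _ _ integral_dsech_soliton_sqr).
- exact: erefl.
- by exact: (continuous_sqr_comp continuous_dsech_soliton).
- by move=> x; rewrite sqr_ge0.
- by move=> x; rewrite dsech_solitonN sqrrN.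
Qed.

(** The first integral expresses [phi^p] through [phi^2] and [phi'^2], whose integrals are known. *)
Lemma Lpowp_sech_soliton : Lpow setT p phi =
  (p / 2 * (lam `^ (p - 2) * soliton_mass - 2 * peak_action))%:E.
Proof.
have iu (h : R -> R) c : continuous h -> Lpow setT 2 h = c%:E ->
    mu.-integrable setT (EFin \o (fun x => h x ^+ 2)).
  move=> ch hc; apply/integrableP; split.
    apply/measurable_EFinP; apply: measurable_funX; exact: continuous_measurable_fun.
  under eq_integral do rewrite /= ger0_norm ?sqr_ge0// -powR2_sqr.
  by rewrite -/(Lpow setT 2 h) hc ltry.
have i1 := iu _ _ continuous_sech_soliton Lpow2_sech_soliton.
have i2 := iu _ _ continuous_dsech_soliton Lpow2_dsech_soliton.
rewrite /Lpow.
under eq_integral => x _ do rewrite sech_soliton_powR EFinM wavenumber_sqr.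
have i1k : mu.-integrable setT (EFin \o (fun x => lam `^ (p - 2) * phi x ^+ 2)).
  exact: (integrableZl measurableT (lam `^ (p - 2)) i1).
rewrite integralZl//; last exact: (integrableB measurableT i1k i2).
rewrite integralB_EFin//.
under eq_integral do rewrite EFinM.
rewrite integralZl//.
have -> : (\int[mu]_x (phi x ^+ 2)%:E)%E = soliton_mass%:E.
  by rewrite -Lpow2_sech_soliton /Lpow; under [RHS]eq_integral do rewrite powR2_sqr.
have -> : (\int[mu]_x (dphi x ^+ 2)%:E)%E = (2 * peak_action)%:E.
  by rewrite -Lpow2_dsech_soliton /Lpow; under [RHS]eq_integral do rewrite powR2_sqr.
by [].
Qed.

Lemma H1_sech_soliton : H1 setT phi.
Proof.
apply: (H1_classical is_derive_sech_soliton continuous_dsech_soliton) => //.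
- by rewrite Lpow2_sech_soliton ltry.
- by rewrite Lpow2_dsech_soliton ltry.
Qed.

(** With [a] the peak action, [w = lam^(p-2)] and [m] the mass, the energy is [a - (w m - 2 a) / 2],
    which is the calibration bound at scale [lam]. *)
Lemma line_energy_sech_soliton : line_energy p phi =
  (2 * peak_action - lam `^ (p - 2) * soliton_mass / 2)%:E.
Proof.
have [gL2 phig] := wderivP H1_sech_soliton.
have RE : [set: R] = \bigcup_n `[- n.+1%:R, n.+1%:R]%classic.
  rewrite predeqE => x; split => // _; exists (Num.truncn `|x|) => //=.
  by rewrite in_itv/= -ler_norml ltW// truncnS_gt.
rewrite /line_energy (Lpow2_weak_derivative is_derive_sech_soliton
  continuous_dsech_soliton measurableT _ RE gL2 phig); last first.
  by move=> n; rewrite gtrN.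
rewrite Lpow2_dsech_soliton Lpowp_sech_soliton -!EFinM -EFinB; congr EFin.
by field; rewrite gt_eqF.
Qed.

End SechSoliton.

(** * The lower bound *)

Section GroundEnergy.
Context {R : realType}.
Variable p : R.
Hypotheses (p_gt2 : 2 < p) (p_lt6 : p < 6).
Implicit Types (lam nu m : R).

Let p0 : 0 < p. Proof. by rewrite (lt_trans _ p_gt2). Qed.
Let q0 : 0 < p - 2. Proof. by rewrite subr_gt0. Qed.

(** The mass is a positive constant times [lam^((6-p)/2)], since [p/2 + 1 - (p - 2) = (6 - p)/2]; as
    [p < 6], this power can be inverted. *)
Lemma soliton_mass_surjective m : 0 < m ->
  exists2 lam, 0 < lam & soliton_mass lam p_gt2 = m.
Proof.
move=> m0; pose c := 2 * (p + 2) / (p - 2) * potential1 p_gt2 (peak1 p).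
have c0 : 0 < c.
  by rewrite mulr_gt0 ?potential1_peak_gt0// divr_gt0// mulr_gt0// addr_gt0.
have s0 : 0 < 6 - p by rewrite subr_gt0.
pose lam := (m / c) `^ (2 / (6 - p)).
have l0 : 0 < lam by rewrite powR_gt0 ?divr_gt0.
exists lam => //; rewrite /soliton_mass /peak_action.
have lE : lam `^ (p / 2 + 1) = lam `^ (p - 2) * (m / c).
  have -> : m / c = lam `^ ((6 - p) / 2).
    rewrite /lam -powRrM -[LHS]powRr1 ?divr_ge0// ?ltW//; congr (_ `^ _).
    by field; rewrite gt_eqF.
  by rewrite -powRD ?(gt_eqF l0) ?implybT//; congr (_ `^ _); field.
have p2 : 0 < p + 2 by rewrite addr_gt0.
rewrite lE /c; field; by rewrite !gt_eqF ?powR_gt0 ?potential1_peak_gt0 ?divr_gt0.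
Qed.

(* Young's inequality with exponent [(p + 2) / (2 (p - 2)) > 1]: this is where
   [p < 6] is used. *)
Lemma ground_energy_le lam nu m : 0 < lam -> 0 < nu ->
  soliton_mass lam p_gt2 = m ->
  2 * peak_action lam p_gt2 - lam `^ (p - 2) * m / 2 <=
  2 * peak_action nu p_gt2 - nu `^ (p - 2) * m / 2.
Proof.
move=> l0 n0 <-; rewrite /soliton_mass /peak_action.
set c := potential1 _ _; have c0 : 0 < c := potential1_peak_gt0 p_gt2.
(* In the variable [a = nu^(p-2)] the bound is [2 c a^sg - a m / 2], convex because [sg > 1]. The
   mass relation reads [m = 4 sg c b^(sg-1)], so [b = lam^(p-2)] is its critical point, and Young's
   inequality is the tangent inequality [a^sg + (sg - 1) b^sg >= sg a b^(sg-1)]. *)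
pose sg := (p + 2) / (2 * (p - 2)).
have p2 : 0 < p + 2 by rewrite addr_gt0.
have sg0 : 0 < sg by rewrite divr_gt0// mulr_gt0.
have sg1 : 0 < sg - 1.
  rewrite subr_gt0 ltr_pdivlMr ?mulr_gt0// mul1r; move: p_lt6; lra.
have powE (a : R) : 0 < a -> a `^ (p / 2 + 1) = (a `^ (p - 2)) `^ sg.
  by move=> a0; rewrite -powRrM; congr (_ `^ _); rewrite /sg; field; rewrite gt_eqF.
rewrite !powE//; set a := nu `^ _; set b := lam `^ _.
have a0 : 0 < a by rewrite powR_gt0.
have b0 : 0 < b by rewrite powR_gt0.
clearbody a b c.
have := conjugate_powR (ltW a0) (powR_ge0 b (sg - 1)) sg0 (divr_gt0 sg0 sg1).
rewrite -[X in _ <= _ + X / _]powRrM.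
have -> : (sg - 1) * (sg / (sg - 1)) = sg by field; exact: lt0r_neq0.
have := mulr_powRB1 (ltW b0) sg0.
move: (b `^ sg) (b `^ (sg - 1)) (a `^ sg) => B b' A <-.
have -> : sg^-1 + (sg / (sg - 1))^-1 = 1.
  by field; rewrite (lt0r_neq0 sg0) (lt0r_neq0 sg1).
move=> /(_ erefl).
have -> : A / sg + b * b' / (sg / (sg - 1)) = (A + (sg - 1) * (b * b')) / sg.
  by field; rewrite (lt0r_neq0 sg0) (lt0r_neq0 sg1).
rewrite (ler_pdivlMr _ _ sg0) => young.
have E x : x * (2 * (p + 2) / (p - 2) * (b * b' * c) / b) / 2 =
    2 * c * (x * b' * sg).
  by rewrite /sg; field; rewrite (lt0r_neq0 q0) (lt0r_neq0 b0).
rewrite !E -subr_ge0.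
have -> : 2 * (A * c) - 2 * c * (a * b' * sg) -
  (2 * (b * b' * c) - 2 * c * (b * b' * sg)) =
  2 * c * (A + (sg - 1) * (b * b') - a * b' * sg) by ring.
by rewrite (mulr_ge0 (mulr_ge0 (ler0n _ 2) (ltW c0)))// subr_ge0.
Qed.

End GroundEnergy.

(** * The energy bound for a finite family of intervals *)

Section EnergyLowerBound.
Context {R : realType}.
Notation mu := (@lebesgue_measure R).
Variable p : R.
Hypotheses (p_gt2 : 2 < p) (p_lt6 : p < 6).

Let p0 : 0 < p. Proof. by rewrite (lt_trans _ p_gt2). Qed.

Lemma ge0_integral_lincomb (I : set R) (a b : R) (f h : R -> R) :
  measurable I -> 0 <= a -> 0 <= b -> measurable_fun I f -> measurable_fun I h ->
  (forall x, 0 <= f x) -> (forall x, 0 <= h x) ->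
  (a%:E * (\int[mu]_(x in I) (f x)%:E) + b%:E * (\int[mu]_(x in I) (h x)%:E) =
   \int[mu]_(x in I) (a * f x + b * h x)%:E)%E.
Proof.
move=> mI a0 b0 mf mh f0 h0.
have mZ (c : R) (k : R -> R) : measurable_fun I k ->
    measurable_fun I (fun x => (c * k x)%:E).
  by move=> mk; apply/measurable_EFinP; exact: measurable_funM.
have Z (c : R) (k : R -> R) : 0 <= c -> measurable_fun I k -> (forall x, 0 <= k x) ->
    (c%:E * (\int[mu]_(x in I) (k x)%:E) = \int[mu]_(x in I) (c * k x)%:E)%E.
  move=> c0 mk k0; rewrite -ge0_integralZl_EFin//; last exact/measurable_EFinP.
  by move=> x _; rewrite lee_fin.
rewrite (Z a f)// (Z b h)// -ge0_integralD//.
- by move=> x _; rewrite lee_fin mulr_ge0.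
- exact: mZ.
- by move=> x _; rewrite lee_fin mulr_ge0.
- exact: mZ.
Qed.

(** The L^p term stands on the left so that both sides are sums of nonnegative extended reals. The
    identity thus holds before the L^p norm is known to be finite, and that finiteness is later read
    off from it. *)
Lemma action_slopeE (lam : R) (I : set R) (u g : R -> R) : 0 < lam ->
  measurable I -> {within I, continuous u} -> in_L2 I g ->
  (forall x, I x -> `|u x| <= lam * peak1 p) ->
  (action (slope p lam) I u g + (p^-1)%:E * Lpow I p u =
   (2^-1)%:E * Lpow I 2 g + (lam `^ (p - 2) / 2)%:E * Lpow I 2 u)%E.
Proof.
move=> l0 mI cu gL2 uM.
have mu_ : measurable_fun I u by exact: subspace_continuous_measurable_fun.
have mp (r : R) (h : R -> R) : measurable_fun I h -> measurable_fun I (fun x => `|h x| `^ r).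
  by move=> mh; apply: (measurableT_comp (measurable_powR _)); exact: measurableT_comp.
have h0' : 0 <= 2^-1 :> R by rewrite invr_ge0.
have p0' : 0 <= p^-1 by rewrite invr_ge0 ltW.
have l0' : 0 <= lam `^ (p - 2) / 2 by rewrite divr_ge0// powR_ge0.
have mg := gL2.1.
have mS : measurable_fun I (fun x => (g x ^+ 2 + slope p lam `|u x| ^+ 2) / 2).
  apply/measurable_EFinP; apply: (measurable_action mI cu gL2).
  exact: continuous_slope.
have S0 x : 0 <= (g x ^+ 2 + slope p lam `|u x| ^+ 2) / 2.
  by rewrite divr_ge0// addr_ge0// sqr_ge0.
have LE := ge0_integral_lincomb mI ler01 p0' mS (mp p u mu_) S0 (fun x => powR_ge0 _ _).
have RE := ge0_integral_lincomb mI h0' l0' (mp 2 g mg) (mp 2 u mu_)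
  (fun x => powR_ge0 _ _) (fun x => powR_ge0 _ _).
rewrite -[action _ _ _ _]mul1e /action /Lpow LE RE.
apply: eq_integral => x /[!inE] Ix; congr EFin.
have := slope_sqr p_gt2 l0 (s := `|u x|); rewrite normr_id => /(_ (uM _ Ix)) ->.
by rewrite !powR2_sqr real_normK ?num_real//; field; exact: lt0r_neq0.
Qed.

Variables (E : finType) (I : E -> set R) (u g : E -> R -> R).
Hypothesis mI : forall e, measurable (I e).
Hypothesis I_convex : forall e x y, I e x -> I e y -> `[x, y] `<=` I e.
Hypothesis cu : forall e, {within I e, continuous (u e)}.
Hypothesis uL2 : forall e, in_L2 (I e) (u e).
Hypothesis gL2 : forall e, in_L2 (I e) (g e).
Hypothesis ug : forall e, weak_derivative (I e) (u e) (g e).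
(* Every value of [u] is taken at least twice, in the form of a lower bound for
   the total variation of [Phi |u|]. *)
Hypothesis double_variation : forall F Phi : R -> R,
  continuous F -> (forall r, 0 <= F r) ->
  (forall r : R, 0 <= r -> is_derive r (1 : R) Phi (F r)) -> Phi 0 = 0 ->
  forall e x, I e x ->
  ((2 * Phi `|u e x|)%:E <= \sum_e action F (I e) (u e) (g e))%E.

(** Boundedness is the Sobolev embedding on each of finitely many intervals; the supremum is
    positive because the mass is. Points with values close to [M] play the part of a maximum
    point. *)
Lemma family_sup (m : R) : 0 < m -> (\sum_e Lpow (I e) 2 (u e))%E = m%:E ->
  exists M : R, [/\ 0 < M, forall e x, I e x -> `|u e x| <= M &
    forall d, 0 < d -> exists e, exists2 x, I e x & M - d < `|u e x|].
Proof.
move=> m0 um; pose A : set R := [set r | exists e, exists2 x, I e x & r = `|u e x|].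
have [B hB] : exists B, forall e x, I e x -> `|u e x| <= B.
  have /choice[b hb] : forall e, exists b, forall x, I e x -> `|u e x| <= b.
    by move=> e; exact: bounded_H1 (mI e) (@I_convex e) (@cu e) (gL2 e) (@ug e) (uL2 e).
  exists (\sum_e `|b e|) => e x Ix; apply: (le_trans (hb _ _ Ix)).
  by rewrite (bigD1 e)//= (le_trans (ler_norm _))// lerDl sumr_ge0.
have [e [x Ix ux]] : exists e, exists2 x, I e x & u e x != 0.
  apply: contrapT => none.
  move: um; rewrite big1; first by case=> mE; rewrite -mE ltxx in m0.
  move=> e _; apply: integral0_eq => x Ix.
  have -> : u e x = 0.
    by apply/eqP/negPn/negP => ux; apply: none; exists e, x.
  by rewrite normr0 powR0.
have supA : has_sup A.
  split; first by exists `|u e x|; exists e, x.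
  by exists B => r [e' [y Iy ->]]; exact: hB.
have A_le e' y : I e' y -> `|u e' y| <= sup A.
  by move=> Iy; apply: ub_le_sup; [exact: supA.2|exists e', y].
exists (sup A); split => //.
- by apply: lt_le_trans (A_le _ _ Ix); rewrite normr_gt0.
- by move=> d d0; have [r [e' [y Iy rE]] hr] := sup_adherent d0 supA; exists e', y; rewrite -?rE.
Qed.

(** This serves both geometries: the family is indexed by [unit] for the line and by the edges for a
    graph, and the geometry enters only through [double_variation]. *)
Lemma family_energy_ge (m lam : R) : 0 < m -> 0 < lam ->
  soliton_mass lam p_gt2 = m -> (\sum_e Lpow (I e) 2 (u e))%E = m%:E ->
  ((2 * peak_action lam p_gt2 - lam `^ (p - 2) * m / 2)%:E <=
   (2^-1)%:E * (\sum_e Lpow (I e) 2 (g e)) - (p^-1)%:E * \sum_e Lpow (I e) p (u e))%E.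
Proof.
have arith (S P K a b x y q : R) : S + q * P = 2^-1 * K + x / 2 * m -> 2 * a <= S ->
    2 * b - y * m / 2 <= 2 * a - x * m / 2 -> 2 * b - y * m / 2 <= 2^-1 * K - q * P.
  by lra.
have arith_eps (a b s eps : R) : `|a - b| <= eps / 2 -> 2 * b <= s -> 2 * a <= s + eps.
  by rewrite ler_norml => /andP[_]; lra.
move=> m0 l0 lm um; have [M [M0 uM Mu]] := family_sup m0 um.
have pk0 := peak1_gt0 p_gt2.
(* The scale at which the slope vanishes exactly at [M], so that the formula for its square covers
   every value of [u]. *)
pose nu := M / peak1 p; have nu0 : 0 < nu by rewrite divr_gt0.
have nuM : nu * peak1 p = M by rewrite /nu divfK// gt_eqF.
have Lge0 r J (h : R -> R) : (0 <= Lpow J r h)%E.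
  by apply: integral_ge0 => x _; rewrite lee_fin powR_ge0.
have fin_sum (f : E -> \bar R) : (forall e, f e < +oo)%E -> (forall e, 0 <= f e)%E ->
    f = (fun e => (fine (f e))%:E).
  by move=> foo f0; apply/funext => e; rewrite fineK// ge0_fin_numE.
pose D e := action (slope p nu) (I e) (u e) (g e).
have id_e e : (D e + (p^-1)%:E * Lpow (I e) p (u e) =
    (2^-1)%:E * Lpow (I e) 2 (g e) + (nu `^ (p - 2) / 2)%:E * Lpow (I e) 2 (u e))%E.
  by apply: action_slopeE => // x Ix; rewrite nuM; exact: uM.
have D0 e : (0 <= D e)%E.
  by apply: integral_ge0 => x _; rewrite lee_fin divr_ge0// addr_ge0 ?sqr_ge0.
have rhs_oo e : ((2^-1)%:E * Lpow (I e) 2 (g e) +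
    (nu `^ (p - 2) / 2)%:E * Lpow (I e) 2 (u e) < +oo)%E.
  rewrite lte_add_pinfty// lte_mul_pinfty ?lee_fin ?divr_ge0 ?powR_ge0//.
  - exact: (gL2 e).2.
  - exact: (uL2 e).2.
have Doo e : (D e < +oo)%E.
  apply: le_lt_trans (rhs_oo e); rewrite -id_e leeDl// mule_ge0// lee_fin invr_ge0 ltW//.
have Poo e : (Lpow (I e) p (u e) < +oo)%E.
  have : ((p^-1)%:E * Lpow (I e) p (u e) < +oo)%E.
    by apply: le_lt_trans (rhs_oo e); rewrite -id_e leeDr.
  have := Lge0 p (I e) (u e); case: (Lpow _ _ _) => [r _ _|_|//].
    exact: ltry.
  by rewrite gt0_muley// lte_fin invr_gt0.
have DE := fin_sum _ Doo D0.
have PE := fin_sum _ Poo (fun e => Lge0 p (I e) (u e)).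
have KE := fin_sum (fun e => Lpow (I e) 2 (g e)) (fun e => (gL2 e).2) (fun e => Lge0 2 (I e) (g e)).
have NE := fin_sum (fun e => Lpow (I e) 2 (u e)) (fun e => (uL2 e).2) (fun e => Lge0 2 (I e) (u e)).
set d := fun e => fine (D e) in DE.
set P := fun e => fine (Lpow (I e) p (u e)) in PE.
set K := fun e => fine (Lpow (I e) 2 (g e)) in KE.
set N := fun e => fine (Lpow (I e) 2 (u e)) in NE.
have idr e : d e + p^-1 * P e = 2^-1 * K e + nu `^ (p - 2) / 2 * N e.
  have := id_e e; rewrite [Lpow _ p _](congr1 (@^~ e) PE) [Lpow _ 2 (g e)](congr1 (@^~ e) KE)
    [Lpow _ 2 (u e)](congr1 (@^~ e) NE) [D e](congr1 (@^~ e) DE).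
  by rewrite -!EFinM -!EFinD => -[].
have sumN : \sum_e N e = m.
  by move: um; rewrite (eq_bigr _ (fun e _ => congr1 (@^~ e) NE)) sumEFin => -[].
rewrite (eq_bigr _ (fun e _ => congr1 (@^~ e) KE)) (eq_bigr _ (fun e _ => congr1 (@^~ e) PE)).
rewrite !sumEFin -!EFinM -EFinB lee_fin.
have sum_id : \sum_e d e + p^-1 * \sum_e P e = 2^-1 * \sum_e K e + nu `^ (p - 2) / 2 * m.
  by rewrite -sumN !mulr_sumr -!big_split; apply: eq_bigr => e _; exact: idr.
have dge e x : I e x -> 2 * potential p_gt2 nu `|u e x| <= \sum_e d e.
  move=> Ix.
  have : ((2 * potential p_gt2 nu `|u e x|)%:E <= \sum_e D e)%E.
    apply: (@double_variation (slope p nu)) Ix.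
    - exact: continuous_slope.
    - exact: slope_ge0.
    - by move=> r; exact: is_derive_potential.
    - exact: potential0.
  by rewrite (eq_bigr _ (fun e _ => congr1 (@^~ e) DE)) sumEFin lee_fin.
(* The bound at points with [|u|] close to [M] passes to [M] by continuity of the potential. *)
have peak_le : 2 * peak_action nu p_gt2 <= \sum_e d e.
  rewrite -potential_peak// nuM.
  have cM : {for M, continuous (potential p_gt2 nu)}.
    exact: is_derive_continuous (is_derive_potential p_gt2 nu0 (ltW M0)).
  apply/ler_addgt0Pr => eps eps0.
  have /cvgrPdist_le/(_ (eps / 2)) := cM; rewrite divr_gt0// => /(_ erefl)[del /= del0 hdel].

  have [e [x Ix ux]] := Mu _ del0.
  have : `|potential p_gt2 nu M - potential p_gt2 nu `|u e x| | <= eps / 2.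
    apply: hdel; rewrite /= ger0_norm ?subr_ge0; last exact: uM.
    by rewrite ltrBlDr -ltrBlDl.
  by move=> /arith_eps; apply; exact: dge.
exact: arith sum_id peak_le (ground_energy_le p_lt6 l0 nu0 lm).
Qed.

End EnergyLowerBound.

Section SmallPotential.
Context {R : realType}.
Notation mu := (@lebesgue_measure R).
Variables (F Phi : R -> R).
Hypothesis F_ge0 : forall r, 0 <= F r.
Hypothesis dPhi : forall r : R, 0 <= r -> is_derive r (1 : R) Phi (F r).
Hypothesis Phi0 : Phi 0 = 0.

Lemma potential_ge0 (r : R) : 0 <= r -> 0 <= Phi r.
Proof.
move=> r0; have [||c _] := @MVT_segment _ Phi F 0 r r0.
- by move=> x /itvP xr; apply: dPhi; rewrite xr.
- apply: derivable_within_continuous => x; rewrite in_itv/= => /andP[x0 _].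
  by have [] := dPhi x0.
by rewrite Phi0 !subr0 => ->; rewrite mulr_ge0.
Qed.

(** Stands in for decay at infinity: a square-integrable function is small somewhere on any set of
    infinite measure, and [Phi] is continuous at 0 with [Phi 0 = 0]. *)
Lemma small_potential (I J : set R) (u : R -> R) eps : measurable I ->
  {within I, continuous u} -> in_L2 I u ->
  measurable J -> J `<=` I -> mu J = +oo%E -> 0 < eps ->
  exists2 x, J x & Phi `|u x| <= eps.
Proof.
move=> mI cu uL2 mJ JI Joo e0.
have c0 : {for 0, continuous Phi} := is_derive_continuous (dPhi (lexx 0)).
have /cvgrPdist_le/(_ _ e0)[d /= d0 hd] := c0.
have [x Jx ux] := small_value mI mJ JI Joo uL2 d0.
exists x => //; have := hd `|u x|; rewrite /= sub0r normrN normr_id => /(_ ux).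
by rewrite Phi0 sub0r normrN ger0_norm// potential_ge0.
Qed.

End SmallPotential.

(** * The lower bound on the real line *)

Section LineLowerBound.
Context {R : realType}.
Notation mu := (@lebesgue_measure R).
Variables (p m lam : R).
Hypotheses (p_gt2 : 2 < p) (p_lt6 : p < 6) (m_gt0 : 0 < m) (lam_gt0 : 0 < lam).
Hypothesis lam_mass : soliton_mass lam p_gt2 = m.

(** [Phi |u|] climbs from nearly 0 at some [s <= x] to its value at [x], then falls back to nearly 0
    at some [t >= x]. *)
Lemma line_double_variation (u g F Phi : R -> R) : continuous u ->
  in_L2 setT u -> in_L2 setT g -> weak_derivative setT u g ->
  continuous F -> (forall r, 0 <= F r) ->
  (forall r : R, 0 <= r -> is_derive r (1 : R) Phi (F r)) -> Phi 0 = 0 ->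
  forall x, ((2 * Phi `|u x|)%:E <= action F setT u g)%E.
Proof.
move=> cu uL2 gL2 ug cF F0 dPhi Phi0 x.
have cuT : {within setT, continuous u} by exact: continuous_subspaceT.
apply/lee_addgt0Pr => eps eps0.
have e2 : 0 < eps / 2 by rewrite divr_gt0.
have [s /= sx us] : exists2 s, `]-oo, x]%classic s & Phi `|u s| <= eps / 2.
  apply: (small_potential F0 dPhi Phi0 measurableT cuT uL2) => //.
  by rewrite /= lebesgue_measure_itv/= ltNyr.
have [t /= xt ut] : exists2 t, `[x, +oo[%classic t & Phi `|u t| <= eps / 2.
  apply: (small_potential F0 dPhi Phi0 measurableT cuT uL2) => //.
  by rewrite /= lebesgue_measure_itv/= ltry.
rewrite in_itv/= in sx; rewrite in_itv/= andbT in xt.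
have sxt : s <= x <= t by rewrite sx xt.
have V := variation_le_action measurableT (fun _ _ _ _ => @subsetT _ _) cuT gL2 ug
  cF F0 dPhi sxt I I.
apply: (@le_trans _ _ ((`|Phi (`|u x|) - Phi (`|u s|)| +
    `|Phi (`|u t|) - Phi (`|u x|)|)%:E + eps%:E)%E); last exact: leeD.
rewrite -EFinD lee_fin.
have := ler_norm (Phi (`|u x|) - Phi (`|u s|)).
have := ler_norm (Phi (`|u x|) - Phi (`|u t|)); rewrite distrC.
by move: us ut; lra.
Qed.

Lemma line_energy_ge (u : R -> R) : line_H1m m u ->
  ((2 * peak_action lam p_gt2 - lam `^ (p - 2) * m / 2)%:E <= line_energy p u)%E.
Proof.
move=> [cu uH1 um]; have [gL2 ug] := wderivP uH1.
have cuT : {within setT, continuous u} by exact: continuous_subspaceT.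
have sum1 (f : unit -> \bar R) : (\sum_e f e)%E = f tt.
  by rewrite (bigD1 tt)//= big1 ?adde0// => -[].
have := @family_energy_ge _ p p_gt2 p_lt6 unit (fun=> setT) (fun=> u)
  (fun=> wderiv setT u) _ _ _ _ _ _ _ m lam m_gt0 lam_gt0 lam_mass.
rewrite !sum1; apply.
- by move=> _; exact: measurableT.
- by move=> _ x y _ _; exact: subsetT.
- by move=> _; exact: cuT.
- by move=> _; exact: uH1.1.
- by move=> _; exact: gL2.
- by move=> _; exact: ug.
- move=> F Phi cF F0 dPhi Phi0 e x _; rewrite sum1.
  exact: (line_double_variation cu uH1.1 gL2 ug cF F0 dPhi Phi0).
- exact: um.
Qed.

End LineLowerBound.

(** * The lower bound on a metric graph *)

Section GraphLowerBound.
Context {R : realType}.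
Notation mu := (@lebesgue_measure R).
Variable G : edge_data R.
Hypothesis G_metric : metric_graph G.
Implicit Types (e : edge G) (v : vertex G).

Lemma interval_halfline e : len e = +oo%E -> Defs.interval e = `[0, +oo[%classic.
Proof.
move=> le; rewrite /Defs.interval le predeqE => x /=; rewrite in_itv/= andbT.
by split=> [[]//|x0]; rewrite leey.
Qed.

Lemma interval_segment e l : len e = l%:E -> Defs.interval e = `[0, l]%classic.
Proof.
move=> le; rewrite /Defs.interval le predeqE => x /=; rewrite in_itv/= lee_fin.
by split=> [[-> ->]|/andP[]].
Qed.

Lemma measurable_interval e : measurable (Defs.interval e).
Proof.
have := len_gt0 G_metric e; case le : (len e) => [l| |]// _.
- by rewrite (interval_segment le).
- by rewrite (interval_halfline le).
Qed.

Lemma interval_convex e x y : Defs.interval e x -> Defs.interval e y ->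
  `[x, y] `<=` Defs.interval e.
Proof.
move=> [x0 _] [_ yl] z; rewrite /= in_itv/= => /andP[xz zy]; split.
  exact: le_trans xz.
by apply: le_trans yl; rewrite lee_fin.
Qed.

Lemma interval0 e : Defs.interval e 0.
Proof. by split => //; exact: ltW (len_gt0 G_metric e). Qed.

(** The half-line [e] already uses up the degree one of its vertex at infinity, so no tail and no
    other head can be there. *)
Lemma halfline_end_degree e f : len e = +oo%E ->
  (Defs.tail f == Defs.head e) || ((f != e) && (Defs.head f == Defs.head e)) -> False.
Proof.
move=> le fe; have hV : Defs.head e \in Vinf G.
  by apply: imset_f; rewrite inE le.
have := degree_Vinf G_metric hV; rewrite /degree.
have [ffe|ffe] := eqVneq f e.
  move: fe; rewrite ffe eqxx andFb orbF => te.
  by rewrite (bigD1 e)//= te eqxx.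
rewrite (bigD1 e)//= (bigD1 f)//= eqxx.
by case/orP: fe => [->|/andP[_ ->]]; rewrite ?addn1 ?add1n ?addnS ?addSn.
Qed.

Lemma tail_notin_Vinf e : Defs.tail e \notin Vinf G.
Proof.
apply/negP => /imsetP[f]; rewrite inE => /eqP lf te.
by apply: (@halfline_end_degree f e lf); rewrite te eqxx.
Qed.

Lemma head_notin_Vinf e l : len e = l%:E -> Defs.head e \notin Vinf G.
Proof.
move=> le; apply/negP => /imsetP[f]; rewrite inE => /eqP lf he.
apply: (@halfline_end_degree f e lf); rewrite he eqxx andbT; apply/orP; right.
by apply/negP => /eqP ef; rewrite ef lf in le.
Qed.

Hypothesis G_infinity : forall (e : edge G) (C : {set vertex G}),
  C \in components [set~ e]%SET ->
  exists v : vertex G, v \in Vinf G /\ v \in C.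

Section DoubleVariation.
Variables (u g : edge G -> R -> R) (F Phi : R -> R).
Hypothesis u_cont : continuous_on_graph u.
Hypothesis uL2 : forall e, in_L2 (Defs.interval e) (u e).
Hypothesis gL2 : forall e, in_L2 (Defs.interval e) (g e).
Hypothesis ug : forall e, weak_derivative (Defs.interval e) (u e) (g e).
Hypothesis (cF : continuous F) (F_ge0 : forall r, 0 <= F r).
Hypothesis dPhi : forall r : R, 0 <= r -> is_derive r (1 : R) Phi (F r).
Hypothesis Phi0 : Phi 0 = 0.

(** The value of [Phi |u|] at a vertex of the metric space; by continuity of [u] it is the same for
    every edge end at [v]. At infinity it is set to 0, the boundary condition required by the
    discrete coarea inequality. *)
Let vertex_value v : R :=
  if v \in Vinf G then 0
  else xget 0 [set r | exists e x, at_vertex e x v /\ r = Phi `|u e x|].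

Let vertex_value_at e x v : v \notin Vinf G -> at_vertex e x v ->
  vertex_value v = Phi `|u e x|.
Proof.
move=> vV ex; rewrite /vertex_value (negbTE vV).
case: xgetP => [r _ [f [y [fy ->]]]|none].
  by rewrite (u_cont.2 f e y x v).
by exfalso; apply: (none (Phi `|u e x|)); exists e, x.
Qed.

Let vertex_value_ge0 v : 0 <= vertex_value v.
Proof.
rewrite /vertex_value; case: ifP => // _.
case: xgetP => [r _ [f [y [_ ->]]]|//].
exact: potential_ge0.
Qed.

Let vertex_value_tail e : vertex_value (Defs.tail e) = Phi `|u e 0|.
Proof. by apply: vertex_value_at; [exact: tail_notin_Vinf|left]. Qed.

(* For a half-line the value [0] at its vertex at infinity is approached along
   a sequence of points, since [u e] is in L^2. *)
Let edge_variation e x : Defs.interval e x ->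
  ((`|Phi `|u e x| - vertex_value (Defs.tail e)| +
    `|vertex_value (Defs.head e) - Phi `|u e x| |)%:E
   <= action F (Defs.interval e) (u e) (g e))%E.
Proof.
move=> xI; have mI := measurable_interval e.
have V s t := @variation_le_action R (Defs.interval e) (u e) (g e) mI
  (@interval_convex e) (u_cont.1 e) (gL2 e) (@ug e) F Phi cF F_ge0 dPhi s x t.
rewrite vertex_value_tail.
have x0 : 0 <= x by case: xI.
have := len_gt0 G_metric e; case le : (len e) => [l| |]// _.
- have xl : x <= l by move: xI => [_]; rewrite le.
  rewrite (@vertex_value_at e l); last by right.
    apply: V; [by rewrite x0|exact: interval0|].
    by split; [exact: le_trans xl|rewrite le].
  exact: head_notin_Vinf le.
- have -> : vertex_value (Defs.head e) = 0.
    by rewrite /vertex_value imset_f// inE le.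
  apply/lee_addgt0Pr => eps eps0.
  have [t /= xt ut] : exists2 t, `[x, +oo[%classic t & Phi `|u e t| <= eps.
    apply: (small_potential F_ge0 dPhi Phi0 mI (u_cont.1 e) (uL2 e)) => //.
      rewrite (interval_halfline le) => z /=; rewrite !in_itv/= !andbT.
      exact: le_trans.
    by rewrite /= lebesgue_measure_itv/= ltry.
  rewrite in_itv/= andbT in xt.
  have tI : Defs.interval e t by split; [exact: le_trans xt|rewrite le leey].
  have := V 0 t; rewrite x0 xt => /(_ isT (interval0 e) tI) H.
  apply: (@le_trans _ _ ((`|Phi (`|u e x|) - Phi (`|u e 0|)| +
    `|Phi (`|u e t|) - Phi (`|u e x|)|)%:E + eps%:E)%E); last exact: leeD.
  rewrite -EFinD lee_fin -addrA lerD2l sub0r normrN.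
  have := ler_normD (Phi (`|u e x|) - Phi (`|u e t|)) (Phi (`|u e t|)).
  rewrite subrK distrC [X in _ <= _ + X](ger0_norm (potential_ge0 F_ge0 dPhi Phi0 _))//.
  lra.
Qed.

(** The point [x] splits [e] in two, and the triangle inequality on each part gives [2 Phi |u e x|]
    at most the variation on [e] plus the values at the two ends of [e]. Those two values are paid
    for by the variation on the other edges. *)
Lemma graph_double_variation e x : Defs.interval e x ->
  ((2 * Phi `|u e x|)%:E <= \sum_f action F (Defs.interval f) (u f) (g f))%E.
Proof.
move=> xI; have pv := potential_variation_ge G_infinity e vertex_value_ge0 _.
have {}pv := pv (fun v vV => ltac:(by rewrite /vertex_value vV)).
rewrite (bigD1 e)//=.
apply: (@le_trans _ _ ((`|Phi `|u e x| - vertex_value (Defs.tail e)| +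
    `|vertex_value (Defs.head e) - Phi `|u e x| |)%:E +
  (\sum_(f | f != e) `|vertex_value (Defs.tail f) - vertex_value (Defs.head f)|)%:E)%E).
  rewrite -EFinD lee_fin.
  have := ler_norm (Phi `|u e x| - vertex_value (Defs.tail e)).
  have := ler_norm (Phi `|u e x| - vertex_value (Defs.head e)).
  rewrite [X in _ <= X -> _]distrC; move: pv; lra.
apply: leeD; first exact: edge_variation.
rewrite -sumEFin; apply: lee_sum => f _.
(* At coordinate 0 the first summand of [edge_variation] vanishes and the second is the difference
   between the two end vertices. *)
apply: le_trans (edge_variation (interval0 f)).
rewrite vertex_value_tail subrr normr0 add0r distrC.
by rewrite lee_fin.
Qed.

End DoubleVariation.

Variables (p m lam : R).
Hypotheses (p_gt2 : 2 < p) (p_lt6 : p < 6) (m_gt0 : 0 < m) (lam_gt0 : 0 < lam).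
Hypothesis lam_mass : soliton_mass lam p_gt2 = m.

Lemma graph_energy_ge (u : edge G -> R -> R) : graph_H1m m u ->
  ((2 * peak_action lam p_gt2 - lam `^ (p - 2) * m / 2)%:E <= graph_energy p u)%E.
Proof.
move=> [[uc uH1] um]; have gw e := wderivP (uH1 e).
apply: (@family_energy_ge _ p p_gt2 p_lt6 _ (@Defs.interval R G) u
  (fun e => wderiv (Defs.interval e) (u e))) => //.
- exact: measurable_interval.
- exact: interval_convex.
- exact: uc.1.
- by move=> e; exact: (uH1 e).1.
- by move=> e; exact: (gw e).1.
- by move=> e; exact: (gw e).2.
- move=> F Phi cF F0 dPhi Phi0 e x xI.
  apply: graph_double_variation => //.
  + by move=> f; exact: (uH1 f).1.
  + by move=> f; exact: (gw f).1.
  + by move=> f; exact: (gw f).2.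
Qed.

End GraphLowerBound.

(** * Competitors on a half-line *)

Lemma continuous_compose {R : realType} (f g : R -> R) : continuous f ->
  continuous g -> continuous (fun x => g (f x)).
Proof. by move=> cf cg x; apply: (@continuous_comp _ _ _ f g); [exact: cf|exact: cg]. Qed.

Lemma continuous_shift_comp {R : realType} (f : R -> R) (a : R) : continuous f ->
  continuous (fun x => f (x + a)).
Proof.
move=> cf; apply: (@continuous_compose _ (fun x => x + a)) => // x.
by apply: cvgD; [exact: cvg_id|exact: cvg_cst].
Qed.

Section ShiftedDifference.
Context {R : realType}.
Notation mu := (@lebesgue_measure R).

Lemma integral_halfline_shift (f : R -> R) (a : R) : continuous f ->
  (forall x, 0 <= f x) ->
  (\int[mu]_(x in `[0%R, +oo[) (f x)%:E =
   \int[mu]_(x in `[(- a)%R, +oo[) (f (x + a))%:E)%E.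
Proof.
move=> cf f0.
have dF x : is_derive x (1 : R) (fun x : R => x + a) 1.
  have H := is_derive_add (is_derive_id x (1 : R)) (is_derive_cst (a : R) x 1).
  by apply: (is_derive_val_eq H); rewrite addr0.
have F'E : (fun x : R => x + a)^`()%classic = cst 1.
  by apply/funext => x; exact: is_derive_derive1.
have := @increasing_ge0_integration_by_substitutiony _ (fun x => x + a) f (- a).
rewrite F'E addNr => ->.
- by apply: eq_integral => x _; rewrite /= mulr1.
- by move=> x y _ _ xy; rewrite ltrD2r.
- by move=> x _; exact: cvg_cst.
- by apply: is_cvg_cst.
- by apply: is_cvg_cst.
- split; first by move=> x _; have [] := dF x.
  by apply: cvg_at_right_filter; exact: is_derive_continuous (dF _).
- exact: cvg_addrr.
- exact: continuous_subspaceT.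
- by move=> x _.
Qed.

Variables (phi h : R -> R) (c r : R).
Hypothesis (ch : continuous h) (cphi : continuous phi) (c0 : 0 <= c) (r0 : 0 < r).
Hypothesis phi_le : forall x y, `|x| <= `|y| -> phi y <= phi x.
Hypothesis phi_ge0 : forall x, 0 <= phi x.
Hypothesis h_le : forall x, `|h x| <= c * phi x.
Hypothesis phi_cvg0 : phi x @[x --> +oo] --> (0 : R).
Hypothesis phi_fin : (Lpow setT r phi < +oo)%E.

Let h_cvg0 : h x @[x --> +oo] --> (0 : R).
Proof.
have cphi0 : c * phi x @[x --> +oo] --> (0 : R).
  by rewrite -[X in _ --> X](mulr0 c); apply: cvgM; [exact: cvg_cst|].
have Ncphi0 : - (c * phi x) @[x --> +oo] --> (0 : R).
  by rewrite -[X in _ --> X]oppr0; exact: cvgN.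
apply: (squeeze_cvgr _ Ncphi0 cphi0).
by near=> x; rewrite -ler_norml.
Unshelve. all: by end_near. Qed.

(** The translation by [n] turns the integral into that of [|h(x) - h(x + 2n)|^r] over [[-n, +oo[].
    The integrand converges pointwise to [|h|^r], with majorant [(2 c phi)^r]. It is applied to the
    soliton and to its derivative. *)
Lemma shifted_difference_cvg :
  Lpow `[0, +oo[ r (fun x => h (x - n%:R) - h (x + n%:R)) @[n --> \oo] -->
  Lpow setT r h.
Proof.
have cr := continuous_powR_norm r0.
pose d n x : R := h x - h (x + n%:R + n%:R).
have cd n : continuous (d n).
  have c1 := @continuous_shift_comp _ h n%:R ch.
  have c2 := @continuous_shift_comp _ (fun y => h (y + n%:R)) n%:R c1.
  by move=> x; apply: cvgB; [exact: ch|exact: c2].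
have LE n : Lpow `[0, +oo[ r (fun x => h (x - n%:R) - h (x + n%:R)) =
    (\int[mu]_x (((fun x => `|d n x| `^ r) \_ `[(- n%:R)%R, +oo[) x)%:E)%E.
  rewrite /Lpow (@integral_halfline_shift (fun x => `|h (x - n%:R) - h (x + n%:R)| `^ r) n%:R).
  - rewrite integral_mkcond; apply: eq_integral => x _; rewrite restrict_EFin.
    by congr EFin; rewrite !patchE; case: ifP => // _; rewrite addrK.
  - apply: (@continuous_compose _ (fun x => h (x - n%:R) - h (x + n%:R))
      (fun s : R => `|s| `^ r)); last exact: cr.
    by move=> x; apply: cvgB; exact: continuous_shift_comp.
  - by move=> x; rewrite powR_ge0.
rewrite (funext LE).
have phi_int : mu.-integrable setT (fun x => ((2 * c) `^ r * `|phi x| `^ r)%:E).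
  have i1 : mu.-integrable setT (fun x => (`|phi x| `^ r)%:E).
    apply/integrableP; split.
      apply/measurable_EFinP; apply: continuous_measurable_fun.
      exact: (continuous_compose cphi cr).
    by under eq_integral do rewrite gee0_abs ?lee_fin ?powR_ge0//.
  exact: (integrableZl measurableT ((2 * c) `^ r) i1).
apply: (@dominated_cvg _ _ _ mu setT measurableT _ _
  (fun x => ((2 * c) `^ r * `|phi x| `^ r)%:E)) => //.
- move=> n; apply/measurable_EFinP/(measurable_restrictT _ _).1 => //.
  apply: measurable_funTS; apply: continuous_measurable_fun.
  exact: (continuous_compose (@cd n) cr).
- move=> x _; apply: cvg_EFin; first by near=> n.
  apply: (@cvg_trans _ ((fun n => `|d n x| `^ r) @ \oo)).
    apply: near_eq_cvg; near=> n; rewrite /= patchE mem_set//= in_itv/= andbT.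
    rewrite lerNl (le_trans (ler_norm _))// normrN.
    by near: n; exact: nbhs_infty_ger.
  have dx : d n x @[n --> \oo] --> h x.
    rewrite -[X in _ --> X]subr0; apply: cvgB; first exact: cvg_cst.
    have xn : x + n%:R + n%:R @[n --> \oo] --> +oo%R.
      apply: (@cvg_trans _ ((fun n : nat => x + (n + n)%:R) @ \oo)).
        by apply: near_eq_cvg; near=> n; rewrite natrD addrA.
      apply/cvgryPge => A; near=> n.
      rewrite -lerBlDl (@le_trans _ _ n%:R)//; last by rewrite ler_nat leq_addr.
      by near: n; exact: nbhs_infty_ger.
    exact: (@cvg_comp _ _ _ (fun n : nat => x + n%:R + n%:R) h _ _ _ xn h_cvg0).
  exact: (@cvg_comp _ _ _ (fun n => d n x) (fun s => `|s| `^ r) _ _ _ dx (cr (h x))).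
- move=> n x _; rewrite patchE; case: ifPn => [|_]; last first.
    by rewrite abse0 lee_fin mulr_ge0 ?powR_ge0.
  rewrite inE/= in_itv/= andbT => nx.
  rewrite /= (ger0_norm (powR_ge0 _ _)) lee_fin (ger0_norm (phi_ge0 x)).
  rewrite -powRM ?mulr_ge0// ge0_ler_powR ?nnegrE ?mulr_ge0 ?(ltW r0)//.
  apply: (le_trans (ler_normB _ _)).
  have := h_le x; have := h_le (x + n%:R + n%:R).
  (* For [x >= -n] one has [|x| <= x + 2n], so the reflected copy is dominated by [phi x] as
     well. *)
  have : c * phi (x + n%:R + n%:R) <= c * phi x.
    apply: ler_wpM2l => //; apply: phi_le.
    have n0 : 0 <= n%:R :> R by [].
    rewrite [leRHS]ger0_norm; last lra.
    by rewrite ler_norml; apply/andP; split; lra.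
  lra.
Unshelve. all: by end_near. Qed.

End ShiftedDifference.

(** * Extension by zero from a half-line to the graph *)

Section HalflineCompetitor.
Context {R : realType}.
Notation mu := (@lebesgue_measure R).
Variable G : edge_data R.
Hypothesis G_metric : metric_graph G.
Implicit Types (e : edge G).

Lemma Lpow_scale (I : set R) (r c : R) (w : R -> R) : measurable I ->
  continuous w -> Lpow I r (fun x => c * w x) = ((`|c| `^ r)%:E * Lpow I r w)%E.
Proof.
move=> mI cw; rewrite /Lpow -ge0_integralZl_EFin ?powR_ge0//.
- by apply: eq_integral => x _; rewrite normrM powRM.
- apply/measurable_EFinP; apply: (measurableT_comp (measurable_powR _)).
  by apply: measurableT_comp => //; apply: measurable_funTS; exact: continuous_measurable_fun.
Qed.

Lemma interval_cover e : exists a b : nat -> R, (forall n, a n < b n) /\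
  Defs.interval e = \bigcup_n `[a n, b n]%classic.
Proof.
have := len_gt0 G_metric e; case le : (Defs.len e) => [l| |]// l0.
  exists (fun=> 0), (fun=> l); split; first by move=> _; rewrite lte_fin in l0.
  by rewrite (interval_segment le) bigcup_const//; exists 0%N.
exists (fun=> 0), (fun n => n.+1%:R); split => //.
rewrite (interval_halfline le) predeqE => x /=; rewrite in_itv/= andbT; split.
  move=> x0; exists (Num.truncn x) => //=.
  by rewrite in_itv/= x0 ltW// truncnS_gt.
by move=> [n _]; rewrite /= in_itv/= => /andP[].
Qed.

Variable e0 : edge G.
Hypothesis len_e0 : Defs.len e0 = +oo%E.
Variables (w dw : R -> R).
Hypothesis dw_w : forall x, is_derive x (1 : R) w (dw x).
Hypothesis cdw : continuous dw.
Hypothesis w0 : w 0 = 0.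

Let cw : continuous w.
Proof. by move=> x; exact: is_derive_continuous (dw_w x). Qed.

(** Zero off [e0] is encoded as a zero coefficient, so every edge carries a multiple of the same C^1
    function and one scaling rule covers all edges. Gluing is continuous because [w 0 = 0] and the
    other end of [e0] is not a point of the graph. *)
Definition halfline_lift (c : R) e (x : R) : R := (if e == e0 then c else 0) * w x.

Variables (p m A B P : R).
Hypotheses (p_gt0 : 0 < p) (m_gt0 : 0 < m) (A_gt0 : 0 < A).
Hypothesis wA : Lpow `[0, +oo[ 2 w = A%:E.
Hypothesis wB : Lpow `[0, +oo[ 2 dw = B%:E.
Hypothesis wP : Lpow `[0, +oo[ p w = P%:E.

Let c : R := Num.sqrt (m / A).
Let coef e : R := if e == e0 then c else 0.

Let sum_coef (r : R) (f : edge G -> \bar R) : 0 < r ->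
  (\sum_e (`|coef e| `^ r)%:E * f e = (`|c| `^ r)%:E * f e0)%E.
Proof.
move=> r0; rewrite (bigD1 e0)//= /coef eqxx big1 ?adde0// => e /negbTE ->.
by rewrite normr0 powR0 ?gt_eqF// mul0e.
Qed.

Let c_sqr : `|c| `^ 2 = m / A.
Proof. by rewrite powR2_sqr sqr_sqrtr// divr_ge0// ltW. Qed.

Let Lpow_fin (h : R -> R) (H : R) e : continuous h -> Lpow `[0, +oo[ 2 h = H%:E ->
  (Lpow (Defs.interval e) 2 (fun x => (coef e * h x)%R) < +oo)%E.
Proof.
move=> ch hH; rewrite Lpow_scale//; last exact: measurable_interval.
rewrite /coef; case: eqP => [->|_].
  by rewrite (interval_halfline len_e0) hH -EFinM ltry.
by rewrite normr0 powR0 ?mul0e.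
Qed.

Let d_lift e x : is_derive x (1 : R) (halfline_lift c e) (coef e * dw x).
Proof. by apply: is_derive_scale; exact: dw_w. Qed.

Let c_dlift e : continuous (fun x => coef e * dw x).
Proof. by move=> x; apply: cvgM; [exact: cvg_cst|exact: cdw]. Qed.

Let H1_lift e : H1 (Defs.interval e) (halfline_lift c e).
Proof.
apply: (H1_classical (d_lift e) (@c_dlift e)).
- exact: measurable_interval.
- exact: Lpow_fin wA.
- exact: Lpow_fin wB.
Qed.

Lemma halfline_lift_H1m : graph_H1m m (halfline_lift c).
Proof.
split; last first.
  rewrite /graph_Lpow (eq_bigr (fun e => (`|coef e| `^ 2)%:E * Lpow (Defs.interval e) 2 w)%E).
    rewrite sum_coef// c_sqr (interval_halfline len_e0) wA -EFinM divfK//.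
    exact: lt0r_neq0.
  by move=> e _; apply: Lpow_scale => //; exact: measurable_interval.
split; last exact: H1_lift.
split.
  move=> e; apply: continuous_subspaceT => x.
  exact: is_derive_continuous (d_lift e x).
have vertex0 e x v : at_vertex e x v -> halfline_lift c e x = 0.
  move=> ev; rewrite /halfline_lift; case: eqP => [ee|_]; last by rewrite mul0r.
  move: ev; rewrite ee => -[[-> _]|[xl _]]; first by rewrite w0 mulr0.
  by move: xl; rewrite len_e0.
by move=> e f x y v ev fv; rewrite (vertex0 _ _ _ ev) (vertex0 _ _ _ fv).
Qed.

Lemma graph_energy_halfline_lift : graph_energy p (halfline_lift c) =
  (2^-1 * (m / A * B) - p^-1 * (`|c| `^ p * P))%:E.
Proof.
rewrite /graph_energy /graph_Lpow.
rewrite (eq_bigr (fun e => (`|coef e| `^ 2)%:E * Lpow (Defs.interval e) 2 dw)%E); last first.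
  move=> e _; have [gL2 ug] := wderivP (H1_lift e).
  have [a [b [ab IE]]] := interval_cover e.
  rewrite (Lpow2_weak_derivative (d_lift e) (@c_dlift e) (measurable_interval G_metric e)
    ab IE gL2 ug).
  by apply: Lpow_scale => //; exact: measurable_interval.
rewrite [X in (_ - _ * X)%E](eq_bigr
  (fun e => (`|coef e| `^ p)%:E * Lpow (Defs.interval e) p w)%E); last first.
  by move=> e _; apply: Lpow_scale => //; exact: measurable_interval.
by rewrite !sum_coef// (interval_halfline len_e0) wB wP c_sqr.
Qed.

End HalflineCompetitor.

(** * Limit of the energies of the competitors *)

Section RecoverySequence.
Context {R : realType}.
Notation mu := (@lebesgue_measure R).
Variables (G : edge_data R) (p m lam : R).
Hypotheses (p_gt2 : 2 < p) (m_gt0 : 0 < m) (lam_gt0 : 0 < lam).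
Hypothesis lam_mass : soliton_mass lam p_gt2 = m.
Hypothesis G_metric : metric_graph G.

Local Notation phi := (sech_soliton p lam).
Local Notation dphi := (dsech_soliton p lam).

Let p0 : 0 < p. Proof. by rewrite (lt_trans _ p_gt2). Qed.

Lemma is_derive_shifted_difference (f df : R -> R) (a x : R) :
  (forall x, is_derive x (1 : R) f (df x)) ->
  is_derive x (1 : R) (fun x => f (x - a) - f (x + a)) (df (x - a) - df (x + a)).
Proof.
move=> fd; have sh b : is_derive x (1 : R) (fun x => f (x + b)) (df (x + b)).
  have H := is_derive_add (is_derive_id x (1 : R)) (is_derive_cst (b : R) x 1).
  have H' := @is_derive_comp _ f (fun x => x + b) x _ _ (fd _) H.
  by apply: (is_derive_val_eq H'); rewrite addr0 mulr1.
exact: (is_derive_sub (sh (- a)) (sh a)).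
Qed.

Lemma shifted_soliton_cvg (h : R -> R) (k r : R) : continuous h -> 0 <= k -> 0 < r ->
  (forall x, `|h x| <= k * phi x) -> (Lpow setT r phi < +oo)%E ->
  Lpow `[0, +oo[ r (fun x => h (x - n%:R) - h (x + n%:R)) @[n --> \oo] -->
  Lpow setT r h.
Proof.
move=> ch k0 r0 hk poo; apply: (@shifted_difference_cvg _ phi h k r).
- exact: ch.
- exact: continuous_sech_soliton.
- exact: k0.
- exact: r0.
- by move=> x y; exact: sech_soliton_le.
- by move=> x; exact: ltW (sech_soliton_gt0 p_gt2 lam_gt0 x).
- exact: hk.
- exact: sech_soliton_cvg0.
- exact: poo.
Qed.

Let w (n : nat) x := phi (x - n%:R) - phi (x + n%:R).
Let dw (n : nat) x := dphi (x - n%:R) - dphi (x + n%:R).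
Let A n := fine (Lpow `[0, +oo[ 2 (w n)).
Let B n := fine (Lpow `[0, +oo[ 2 (dw n)).
Let P n := fine (Lpow `[0, +oo[ p (w n)).

Let phi_le1 x : `|phi x| <= 1 * phi x.
Proof. by rewrite mul1r ger0_norm// ltW// sech_soliton_gt0. Qed.

Let A_cvg : Lpow `[0, +oo[ 2 (w n) @[n --> \oo] --> m%:E.
Proof.
rewrite -lam_mass -(Lpow2_sech_soliton p_gt2 lam_gt0).
apply: (@shifted_soliton_cvg _ 1) => //; first exact: continuous_sech_soliton.
by rewrite Lpow2_sech_soliton// ltry.
Qed.

Let B_cvg : Lpow `[0, +oo[ 2 (dw n) @[n --> \oo] --> (2 * peak_action lam p_gt2)%:E.
Proof.
rewrite -(Lpow2_dsech_soliton p_gt2 lam_gt0).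
apply: (@shifted_soliton_cvg _ (wavenumber p lam)) => //.
- exact: continuous_dsech_soliton.
- by rewrite ltW// wavenumber_gt0.
- by move=> x; exact: dsech_soliton_le.
- by rewrite Lpow2_sech_soliton// ltry.
Qed.

Let P_cvg : Lpow `[0, +oo[ p (w n) @[n --> \oo] -->
  (p / 2 * (lam `^ (p - 2) * m - 2 * peak_action lam p_gt2))%:E.
Proof.
rewrite -lam_mass -(Lpowp_sech_soliton p_gt2 lam_gt0).
apply: (@shifted_soliton_cvg _ 1) => //; first exact: continuous_sech_soliton.
by rewrite Lpowp_sech_soliton// ltry.
Qed.

(** The squared L^2 norms [A n] tend to [m], so the normalising factors tend to 1 and the energies
    have the limit computed from the three limiting integrals, which is the soliton energy. *)
Lemma ereal_inf_graph_energy_le (e0 : edge G) : Defs.len e0 = +oo%E ->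
  (ereal_inf [set graph_energy p u | u in graph_H1m (G := G) m] <=
   (2 * peak_action lam p_gt2 - lam `^ (p - 2) * m / 2)%:E)%E.
Proof.
move=> le0.
have [finA cA] := (fine_cvgP _ _).1 A_cvg.
have [finB cB] := (fine_cvgP _ _).1 B_cvg.
have [finP cP] := (fine_cvgP _ _).1 P_cvg.
pose c n := Num.sqrt (m / A n).
pose En n := 2^-1 * (m / A n * B n) - p^-1 * (`|c n| `^ p * P n).
have mA : m / A n @[n --> \oo] --> (1 : R).
  rewrite -(@divff _ m); last exact: lt0r_neq0.
  by apply: cvgM; [exact: cvg_cst|apply: cvgV => //; exact: lt0r_neq0].
have cc : `|c n| `^ p @[n --> \oo] --> (1 : R).
  have -> : (1 : R) = `|Num.sqrt 1| `^ p by rewrite sqrtr1 normr1 powR1.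
  apply: (@cvg_comp _ _ _ (fun n => m / A n) (fun s => `|Num.sqrt s| `^ p) _ _ _ mA).
  exact: (continuous_compose (@sqrt_continuous R) (continuous_powR_norm p0)).
have cE : En n @[n --> \oo] --> (2 * peak_action lam p_gt2 - lam `^ (p - 2) * m / 2).
  have -> : 2 * peak_action lam p_gt2 - lam `^ (p - 2) * m / 2 =
    2^-1 * (1 * (2 * peak_action lam p_gt2)) -
    p^-1 * (1 * (p / 2 * (lam `^ (p - 2) * m - 2 * peak_action lam p_gt2))).
    by field; exact: lt0r_neq0.
  apply: cvgB; apply: cvgM; try exact: cvg_cst; apply: cvgM => //.
have near_le : \forall n \near \oo,
    (ereal_inf [set graph_energy p u | u in graph_H1m (G := G) m] <= (En n)%:E)%E.
  (* For large [n], [A n] is positive and the three integrals are finite, as their limits are; only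
     then is the normalisation meaningful. *)
  apply: filterS (filterI (filterI (cvgr_gt _ cA _ m_gt0) finA) (filterI finB finP)).
  move=> n [[An fA] [fB fP]].
  have w_der x : is_derive x (1 : R) (w n) (dw n x).
    by apply: is_derive_shifted_difference => y; exact: is_derive_sech_soliton.
  have dw_cont : continuous (dw n).
    by move=> x; apply: cvgB; apply: continuous_shift_comp; exact: continuous_dsech_soliton.
  have wn0 : w n 0 = 0 by rewrite /w sub0r add0r sech_solitonN// subrr.
  have AE : Lpow `[0, +oo[ 2 (w n) = (A n)%:E.
    by apply/esym/fineK; exact: fA.
  have BE : Lpow `[0, +oo[ 2 (dw n) = (B n)%:E.
    by apply/esym/fineK; exact: fB.
  have PE : Lpow `[0, +oo[ p (w n) = (P n)%:E.
    by apply/esym/fineK; exact: fP.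
  rewrite -(graph_energy_halfline_lift G_metric le0 w_der dw_cont p0 m_gt0 An AE BE PE).
  apply: ereal_inf_lbound; exists (halfline_lift e0 (w n) (c n)); last exact: erefl.
  exact: (halfline_lift_H1m G_metric le0 w_der dw_cont wn0 m_gt0 An AE BE).
apply/lee_addgt0Pr => eps eps0.
near \oo => n.
apply: (@le_trans _ _ (En n)%:E); first by near: n.
rewrite -EFinD lee_fin ltW//; near: n.
by apply: (cvgr_lt _ cE); rewrite ltrDl.
Unshelve. all: by end_near. Qed.

End RecoverySequence.

(** After removing any edge, the component of its tail contains a vertex at infinity, and such a
    vertex is by definition the head of a half-line. *)
Lemma exists_halfline {R : realType} (G : edge_data R) : metric_graph G ->
  (forall (e : edge G) (C : {set vertex G}), C \in components [set~ e]%SET ->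
    exists v : vertex G, v \in Vinf G /\ v \in C) ->
  exists e : edge G, Defs.len e = +oo%E.
Proof.
move=> G_metric G_infinity; have /card_gt0P[e _] := edge_nonempty G_metric.
have [|v [/imsetP[f]]] := G_infinity e
  [set w | connect (adj [set~ e]%SET) (Defs.tail e) w]%SET.
  exact: imset_f.
by rewrite inE => /eqP lf _ _; exists f.
Qed.

Theorem theorem2p3 (R : realType) (m p : R) (G : edge_data R)
  (m_gt0 : 0 < m) (p_gt2 : 2 < p) (p_lt6 : p < 6)
  (G_metric : metric_graph G)
  (G_infinity : forall (e : edge G) (C : {set vertex G}),
      C \in components [set~ e]%SET ->
      exists v : vertex G, v \in Vinf G /\ v \in C) :
  [/\ ereal_inf [set graph_energy p u | u in graph_H1m (G := G) m] =
        ereal_inf [set line_energy p f | f in line_H1m m],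
      line_minimizer p m (soliton p m) &
      ereal_inf [set line_energy p f | f in line_H1m m] =
        line_energy p (soliton p m)].
Proof.
have [lam lam0 lam_mass] := soliton_mass_surjective p_gt2 p_lt6 m_gt0.
have phi0 := sech_soliton_gt0 p_gt2 lam0.
have lineE := line_energy_sech_soliton p_gt2 lam0.
rewrite lam_mass in lineE.
have phi_min : line_minimizer p m (sech_soliton p lam).
  split; last first.
    move=> u um; rewrite lineE.
    exact: (@line_energy_ge R p m lam p_gt2 p_lt6 m_gt0 lam0 lam_mass u um).
  split; [exact: continuous_sech_soliton|exact: H1_sech_soliton|].
  by rewrite (Lpow2_sech_soliton p_gt2 lam0) lam_mass.
(* [soliton] is a choice among the positive even minimizers; [sech_soliton] shows that there is one,
   so the default value is excluded. Two minimizers have the same energy, which transfers the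
   computed value to [soliton]. *)
have [sol_min _ _] : [/\ line_minimizer p m (soliton p m),
    forall x, 0 < soliton p m x & forall x, soliton p m (- x) = soliton p m x].
  rewrite /soliton; case: xgetP => [f _ //|/(_ (sech_soliton p lam))]; case.
  split; [exact: phi_min|exact: phi0|].
  by move=> x; exact: sech_solitonN.
have solE : line_energy p (soliton p m) = line_energy p (sech_soliton p lam).
  apply/le_anti/andP; split.
    exact: sol_min.2 _ phi_min.1.
  exact: phi_min.2 _ sol_min.1.
have infE : ereal_inf [set line_energy p f | f in line_H1m m] =
    line_energy p (soliton p m).
  apply/le_anti/andP; split.
    by apply: ereal_inf_lbound; exists (soliton p m); [exact: sol_min.1|exact: erefl].
  by apply: le_ereal_inf_tmp => _ [u um <-]; exact: sol_min.2.
split; [|exact: sol_min|exact: infE]; rewrite infE solE lineE; apply/le_anti/andP; split.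
  have [e0 le0] := exists_halfline G_metric G_infinity.
  exact: (ereal_inf_graph_energy_le m_gt0 lam0 lam_mass G_metric le0).
apply: le_ereal_inf_tmp => _ [u um <-].
exact: (graph_energy_ge G_metric G_infinity p_lt6 m_gt0 lam0 lam_mass um).
Qed.
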